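(* Let $(V,\mu,R)$ be a braided algebra over a unital commutative ring $\mathbb{k}$. If $H^3_{\rm YBH}(V,V)=0$, then any infinitesimal deformation of $(V,\mu,R)$ can be extended to a quadratic deformation.
   Context: $\otimes=\otimes_{\mathbb{k}}$, $\mathrm{Hom}=\mathrm{Hom}_{\mathbb{k}}$, and $1$ denotes the identity map of $V$. A Yang-Baxter (YB) operator on a $\mathbb{k}$-module $V$ is an invertible map $R:V\otimes V\to V\otimes V$ with $(R\otimes 1)(1\otimes R)(R\otimes 1)=(1\otimes R)(R\otimes 1)(1\otimes R)$. A braided algebra $(V,\mu,R)$ is an associative $\mathbb{k}$-algebra $(V,\mu)$ with a YB operator $R$ on $V$ satisfying (YI) $(1\otimes\mu)(R\otimes 1)(1\otimes R)=R(\mu\otimes 1)$ and (IY) $(\mu\otimes 1)(1\otimes R)(R\otimes 1)=R(1\otimes\mu)$. The same definition applies over other commutative rings. An infinitesimal deformation is a braided algebra structure $(\mu+\hbar\psi_1,R+\hbar\phi_1)$ over $\mathbb{k}[[\hbar]]/(\hbar^2)$ on $V\otimes\mathbb{k}[[\hbar]]/(\hbar^2)$, with $\psi_1\in\mathrm{Hom}(V^{\otimes 2},V)$, $\phi_1\in\mathrm{Hom}(V^{\otimes 2},V^{\otimes 2})$. A quadratic deformation extending it is a braided algebra structure $(\mu+\hbar\psi_1+\hbar^2\psi_2,\ R+\hbar\phi_1+\hbar^2\phi_2)$ over $\mathbb{k}[[\hbar]]/(\hbar^3)$ on $V\otimes\mathbb{k}[[\hbar]]/(\hbar^3)$. Cochains: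 $C^2_{\rm YBH}(V,V)=\mathrm{Hom}(V^{\otimes 2},V^{\otimes 2})\oplus\mathrm{Hom}(V^{\otimes 2},V)$ (elements $\phi\oplus\psi$), and $C^3_{\rm YBH}(V,V)=\mathrm{Hom}(V^{\otimes 3},V^{\otimes 3})\oplus C^{3,2}_{\rm YI}\oplus C^{3,2}_{\rm IY}\oplus\mathrm{Hom}(V^{\otimes 3},V)$ with $C^{3,2}_{\rm YI}=C^{3,2}_{\rm IY}=\mathrm{Hom}(V^{\otimes 3},V^{\otimes 2})$ (elements $\beta\oplus\alpha\oplus\alpha'\oplus\gamma$). Second differential: $\delta^2_{\rm YBH}(\phi\oplus\psi)=\delta^2_{\rm YB}(\phi)\oplus\delta^2_{\rm YI}(\phi\oplus\psi)\oplus\delta^2_{\rm IY}(\phi\oplus\psi)\oplus\delta^2_{\rm H}(\psi)$, where $\delta^2_{\rm YB}(\phi)=(R\otimes 1)(1\otimes R)(\phi\otimes 1)+(R\otimes 1)(1\otimes\phi)(R\otimes 1)+(\phi\otimes 1)(1\otimes R)(R\otimes 1)-(1\otimes R)(R\otimes 1)(1\otimes\phi)-(1\otimes R)(\phi\otimes 1)(1\otimes R)-(1\otimes\phi)(R\otimes 1)(1\otimes R)$; $\delta^2_{\rm H}(\psi)=\mu(\psi\otimes 1)+\psi(\mu\otimes 1)-\mu(1\otimes\psi)-\psi(1\otimes\mu)$; $\delta^2_{\rm YI}(\phi\oplus\psi)=(1\otimes\psi)(R\otimes 1)(1\otimes R)+(1\otimes\mu)(\phi\otimes 1)(1\otimes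 R)+(1\otimes\mu)(R\otimes 1)(1\otimes\phi)-R(\psi\otimes 1)-\phi(\mu\otimes 1)$; $\delta^2_{\rm IY}(\phi\oplus\psi)=(\psi\otimes 1)(1\otimes R)(R\otimes 1)+(\mu\otimes 1)(1\otimes\phi)(R\otimes 1)+(\mu\otimes 1)(1\otimes R)(\phi\otimes 1)-R(1\otimes\psi)-\phi(1\otimes\mu)$. Third differential: on $V^{\otimes 4}$ write $R_1=R\otimes 1^{\otimes 2}$, $R_2=1\otimes R\otimes 1$, $R_3=1^{\otimes 2}\otimes R$, $\beta_1=\beta\otimes 1$, $\beta_2=1\otimes\beta$. Then $\delta^3_{\rm YBH}(\beta\oplus\alpha\oplus\alpha'\oplus\gamma)$ is the tuple with components $\delta^3_{\rm YB}(\beta)\in\mathrm{Hom}(V^{\otimes 4},V^{\otimes 4})$; $\delta^{3,1}_{\rm YI}(\beta\oplus\alpha),\ \delta^{3,1}_{\rm IY}(\beta\oplus\alpha')\in\mathrm{Hom}(V^{\otimes 4},V^{\otimes 3})$; $\delta^{3,2}_{\rm YI}(\alpha\oplus\alpha'),\ \delta^{3,3}_{\rm YI}(\alpha\oplus\gamma),\ \delta^{3,3}_{\rm IY}(\alpha'\oplus\gamma)\in\mathrm{Hom}(V^{\otimes 4},V^{\otimes 2})$; $\delta^3_{\rm H}(\gamma)\in\mathrm{Hom}(V^{\otimes 4},V)$, where $\delta^3_{\rm YB}(\beta)=\beta_1R_3R_2R_1+R_2R_1\beta_2R_1+R_2R_3\beta_1R_3+\beta_2R_1R_2R_3-R_1R_2R_3\beta_1-R_1\beta_2R_1R_2-R_3\beta_1R_3R_2-R_3R_2R_1\beta_2$;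 $\delta^{3,1}_{\rm YI}(\beta\oplus\alpha)=(1\otimes R)(\alpha\otimes 1)R_3+(1\otimes\alpha)R_1R_2R_3+(1^{\otimes 2}\otimes\mu)R_2R_1\beta_2+(1^{\otimes 2}\otimes\mu)\beta_1R_3R_2-\beta(\mu\otimes 1^{\otimes 2})-(R\otimes 1)(1\otimes R)(\alpha\otimes 1)-(R\otimes 1)(1\otimes\alpha)R_1R_2$; $\delta^{3,1}_{\rm IY}(\beta\oplus\alpha')=(R\otimes 1)(1\otimes\alpha')R_1+(\alpha'\otimes 1)R_3R_2R_1-(\mu\otimes 1^{\otimes 2})R_2R_3\beta_1-(\mu\otimes 1^{\otimes 2})\beta_2R_1R_2+\beta(1^{\otimes 2}\otimes\mu)-(1\otimes R)(R\otimes 1)(1\otimes\alpha')-(1\otimes R)(\alpha'\otimes 1)R_3R_2$; $\delta^{3,2}_{\rm YI}(\alpha\oplus\alpha')=\alpha'(\mu\otimes 1^{\otimes 2})+(\mu\otimes 1)(1\otimes R)(\alpha\otimes 1)+(\mu\otimes 1)(1\otimes\alpha)R_1R_2-\alpha(1^{\otimes 2}\otimes\mu)-(1\otimes\mu)(R\otimes 1)(1\otimes\alpha')-(1\otimes\mu)(\alpha'\otimes 1)R_3R_2$; $\delta^{3,3}_{\rm YI}(\alpha\oplus\gamma)=R(\gamma\otimes 1)+\alpha(\mu\otimes 1^{\otimes 2})+(1\otimes\mu)(\alpha\otimes 1)R_3-\alpha(1\otimes\mu\otimes 1)-(1\otimes\mu)(R\otimes 1)(1\otimes\alpha)-(1\otimes\gamma)R_1R_2R_3$;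 $\delta^{3,3}_{\rm IY}(\alpha'\oplus\gamma)=-R(1\otimes\gamma)+\alpha'(1^{\otimes 2}\otimes\mu)+(\mu\otimes 1)(1\otimes\alpha')R_1-\alpha'(1\otimes\mu\otimes 1)-(\mu\otimes 1)(1\otimes R)(\alpha'\otimes 1)+(\gamma\otimes 1)R_3R_2R_1$; $\delta^3_{\rm H}(\gamma)=\mu(\gamma\otimes 1)+\mu(1\otimes\gamma)+\gamma(1\otimes\mu\otimes 1)-\gamma(\mu\otimes 1^{\otimes 2})-\gamma(1^{\otimes 2}\otimes\mu)$. $H^3_{\rm YBH}(V,V)=\ker\delta^3_{\rm YBH}/\mathrm{Im}\,\delta^2_{\rm YBH}$. *)

(* Defs.v *)
From HB Require Import structures.
From mathcomp Require Import all_boot all_algebra.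
From mathcomp Require Import boolp.

Set Implicit Arguments.
Unset Strict Implicit.
Unset Printing Implicit Defensive.

Import GRing.Theory.

Local Open Scope ring_scope.
Local Open Scope quotient_scope.

(* The ground ring is an arbitrary commutative unital ring, including the zero
   ring: hence comPzRingType and not comNzRingType.  MathComp has no tensor
   product of modules over a ring and no module structure on {linear U -> W},
   so both are set up here. *)

(** * The k-module of linear maps *)

Definition mklin (k : pzRingType) (U W : lmodType k) (f : U -> W)
    (lf : linear f) : {linear U -> W} :=
  HB.pack f (GRing.isLinear.Build k U W *:%R f lf).

Lemma lin_ext (k : pzRingType) (U W : lmodType k) (f g : {linear U -> W}) :
  f =1 g -> f = g.
Proof.
case: f g => [f [[fD] [fZ]]] [g [[gD] [gZ]]] /= /funext fg.
case: _ / fg in gD gZ *.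
by rewrite (Prop_irrelevance fD gD) (Prop_irrelevance fZ gZ).
Qed.

HB.instance Definition _ (k : pzRingType) (U W : lmodType k) :=
  gen_eqMixin {linear U -> W}.
HB.instance Definition _ (k : pzRingType) (U W : lmodType k) :=
  gen_choiceMixin {linear U -> W}.

Section LinearMaps.
Variables (k : comPzRingType) (U W : lmodType k).
Implicit Types f g h : {linear U -> W}.

Definition lin0 : {linear U -> W} := \0.
Definition lin_opp f : {linear U -> W} := \- f.
Definition lin_add f g : {linear U -> W} := f \+ g.

Fact lin_scale_subproof a f : linear (fun x => a *: f x).
Proof. by move=> b x y; rewrite linearP scalerDr !scalerA mulrC. Qed.
Definition lin_scale a f := mklin (lin_scale_subproof a f).

Fact lin_addA : associative lin_add.
Proof. by move=> f g h; apply: lin_ext => x /=; rewrite addrA. Qed.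
Fact lin_addC : commutative lin_add.
Proof. by move=> f g; apply: lin_ext => x /=; rewrite addrC. Qed.
Fact lin_add0 : left_id lin0 lin_add.
Proof. by move=> f; apply: lin_ext => x /=; rewrite add0r. Qed.
Fact lin_addN : left_inverse lin0 lin_opp lin_add.
Proof. by move=> f; apply: lin_ext => x /=; rewrite addNr. Qed.
HB.instance Definition _ :=
  GRing.isZmodule.Build {linear U -> W} lin_addA lin_addC lin_add0 lin_addN.

Fact lin_scaleA a b f : lin_scale a (lin_scale b f) = lin_scale (a * b) f.
Proof. by apply: lin_ext => x /=; rewrite scalerA. Qed.
Fact lin_scale1 : left_id 1 lin_scale.
Proof. by move=> f; apply: lin_ext => x /=; rewrite scale1r. Qed.
Fact lin_scaleDr : right_distributive lin_scale +%R.
Proof. by move=> a f g; apply: lin_ext => x /=; rewrite scalerDr. Qed.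
Fact lin_scaleDl f : {morph lin_scale^~ f : a b / a + b}.
Proof. by move=> a b; apply: lin_ext => x /=; rewrite scalerDl. Qed.
HB.instance Definition _ := GRing.Zmodule_isLmodule.Build k {linear U -> W}
  lin_scaleA lin_scale1 lin_scaleDr lin_scaleDl.

Lemma lin_addE f g x : (f + g) x = f x + g x. Proof. by []. Qed.
Lemma lin_scaleE a f x : (a *: f) x = a *: f x. Proof. by []. Qed.

End LinearMaps.

Definition lin_comp (k : comPzRingType) (U V W : lmodType k)
  (g : {linear V -> W}) (f : {linear U -> V}) : {linear U -> W} := g \o f.

Lemma lin_compE (k : comPzRingType) (U V W : lmodType k)
  (g : {linear V -> W}) (f : {linear U -> V}) x : lin_comp g f x = g (f x).
Proof. by []. Qed.

Definition lin_id (k : comPzRingType) (U : lmodType k) : {linear U -> U} :=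
  idfun.

(** * Modules given by generators and relations *)

Inductive mod_expr (k X : Type) : Type :=
| MGen of X
| MZero
| MOpp of mod_expr k X
| MAdd of mod_expr k X & mod_expr k X
| MScale of k & mod_expr k X.
Arguments MGen k {X} _.
Arguments MZero {k X}.

HB.instance Definition _ (k X : Type) := gen_eqMixin (mod_expr k X).
HB.instance Definition _ (k X : Type) := gen_choiceMixin (mod_expr k X).

(* The congruence generated by the module axioms and the relations E. *)
Inductive mod_cong (k : pzRingType) (X : Type)
    (E : mod_expr k X -> mod_expr k X -> Prop) :
    mod_expr k X -> mod_expr k X -> Prop :=
| mc_rel s t of E s t : mod_cong E s t
| mc_refl s : mod_cong E s s
| mc_sym s t of mod_cong E s t : mod_cong E t s
| mc_trans s t u of mod_cong E s t & mod_cong E t u : mod_cong E s u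
| mc_opp s t of mod_cong E s t : mod_cong E (MOpp s) (MOpp t)
| mc_add s t s' t' of mod_cong E s t & mod_cong E s' t' :
    mod_cong E (MAdd s s') (MAdd t t')
| mc_scale a s t of mod_cong E s t :
    mod_cong E (MScale a s) (MScale a t)
| mc_addA s t u : mod_cong E (MAdd s (MAdd t u)) (MAdd (MAdd s t) u)
| mc_addC s t : mod_cong E (MAdd s t) (MAdd t s)
| mc_add0 s : mod_cong E (MAdd MZero s) s
| mc_addN s : mod_cong E (MAdd (MOpp s) s) MZero
| mc_scaleA a b s :
    mod_cong E (MScale a (MScale b s)) (MScale (a * b) s)
| mc_scale1 s : mod_cong E (MScale 1 s) s
| mc_scaleDr a s t :
    mod_cong E (MScale a (MAdd s t)) (MAdd (MScale a s) (MScale a t))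
| mc_scaleDl a b s :
    mod_cong E (MScale (a + b) s) (MAdd (MScale a s) (MScale b s)).

Section PresentedModule.
Variables (k : pzRingType) (X : Type).
Variable E : mod_expr k X -> mod_expr k X -> Prop.

Definition mod_congb : rel (mod_expr k X) :=
  fun s t => `[< mod_cong E s t >].

Fact mod_congb_refl : reflexive mod_congb.
Proof. by move=> s; apply/asboolP/mc_refl. Qed.
Fact mod_congb_sym : symmetric mod_congb.
Proof. by move=> s t; apply/asboolP/asboolP; apply: mc_sym. Qed.
Fact mod_congb_trans : transitive mod_congb.
Proof.
by move=> t s u /asboolP st /asboolP tu; apply/asboolP/(mc_trans st tu).
Qed.
Canonical mod_cong_equiv :=
  EquivRel mod_congb mod_congb_refl mod_congb_sym mod_congb_trans.

Definition pmod : Type := {eq_quot mod_cong_equiv}.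
HB.instance Definition _ := Choice.on pmod.

Definition pcls (s : mod_expr k X) : pmod := \pi_{eq_quot mod_cong_equiv} s.
Definition prep (x : pmod) : mod_expr k X :=
  repr (x : {eq_quot mod_cong_equiv}).

Lemma prepK x : pcls (prep x) = x.
Proof. exact: (@reprK _ {eq_quot mod_cong_equiv}). Qed.

Lemma pclsP s t : pcls s = pcls t <-> mod_cong E s t.
Proof.
by split=> [/eqmodP/asboolP //|st]; apply/eqmodP/asboolP.
Qed.

Lemma prep_cls s : mod_cong E (prep (pcls s)) s.
Proof. by apply/pclsP; rewrite prepK. Qed.

Lemma pcls_ind (P : pmod -> Prop) : (forall s, P (pcls s)) -> forall x, P x.
Proof. by move=> Ps x; rewrite -(prepK x). Qed.

Definition pzero : pmod := pcls MZero.
Definition popp (x : pmod) : pmod := pcls (MOpp (prep x)).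
Definition padd (x y : pmod) : pmod := pcls (MAdd (prep x) (prep y)).
Definition pscale (a : k) (x : pmod) : pmod := pcls (MScale a (prep x)).

Lemma popp_cls s : popp (pcls s) = pcls (MOpp s).
Proof. exact/pclsP/mc_opp/prep_cls. Qed.
Lemma padd_cls s t : padd (pcls s) (pcls t) = pcls (MAdd s t).
Proof. by apply/pclsP/mc_add; apply: prep_cls. Qed.
Lemma pscale_cls a s : pscale a (pcls s) = pcls (MScale a s).
Proof. exact/pclsP/mc_scale/prep_cls. Qed.

Fact paddA : associative padd.
Proof.
elim/pcls_ind=> s; elim/pcls_ind=> t; elim/pcls_ind=> u.
by rewrite !padd_cls; apply/pclsP/mc_addA.
Qed.
Fact paddC : commutative padd.
Proof.
by elim/pcls_ind=> s; elim/pcls_ind=> t; rewrite !padd_cls; apply/pclsP/mc_addC.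
Qed.
Fact padd0 : left_id pzero padd.
Proof. by elim/pcls_ind=> s; rewrite padd_cls; apply/pclsP/mc_add0. Qed.
Fact paddN : left_inverse pzero popp padd.
Proof. by elim/pcls_ind=> s; rewrite popp_cls padd_cls; apply/pclsP/mc_addN. Qed.
HB.instance Definition _ := GRing.isZmodule.Build pmod paddA paddC padd0 paddN.

Fact pscaleA a b x : pscale a (pscale b x) = pscale (a * b) x.
Proof. by elim/pcls_ind: x => s; rewrite !pscale_cls; apply/pclsP/mc_scaleA. Qed.
Fact pscale1 : left_id 1 pscale.
Proof. by elim/pcls_ind=> s; rewrite pscale_cls; apply/pclsP/mc_scale1. Qed.
Fact pscaleDr : right_distributive pscale +%R.
Proof.
move=> a; elim/pcls_ind=> s; elim/pcls_ind=> t.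
by rewrite /+%R /= !(padd_cls, pscale_cls); apply/pclsP/mc_scaleDr.
Qed.
Fact pscaleDl x : {morph pscale^~ x : a b / a + b >-> a + b}.
Proof.
move=> a b; elim/pcls_ind: x => s.
by rewrite [in RHS]/+%R /= !(padd_cls, pscale_cls); apply/pclsP/mc_scaleDl.
Qed.
HB.instance Definition _ := GRing.Zmodule_isLmodule.Build k pmod
  pscaleA pscale1 pscaleDr pscaleDl.

Definition pgen (x : X) : pmod := pcls (MGen k x).

Lemma pclsE :
  [/\ pcls MZero = 0, {morph pcls : s / MOpp s >-> - s},
      {morph pcls : s t / MAdd s t >-> s + t}
    & forall a, {morph pcls : s / MScale a s >-> a *: s}].
Proof.
split=> // [s|s t|a s]; first exact/esym/popp_cls.
  exact/esym/padd_cls.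
exact/esym/pscale_cls.
Qed.

Section Eval.
Variables (M : lmodType k) (f : X -> M).

Fixpoint mod_eval (s : mod_expr k X) : M :=
  match s with
  | MGen x => f x
  | MZero => 0
  | MOpp s => - mod_eval s
  | MAdd s t => mod_eval s + mod_eval t
  | MScale a s => a *: mod_eval s
  end.

Definition plift_fun (x : pmod) : M := mod_eval (prep x).

Hypothesis frel : forall s t, E s t -> mod_eval s = mod_eval t.

Lemma mod_eval_cong s t : mod_cong E s t -> mod_eval s = mod_eval t.
Proof.
elim=> {s t} //=.
- by move=> s t u _ -> _ ->.
- by move=> s t _ ->.
- by move=> s t s' t' _ -> _ ->.
- by move=> a s t _ ->.
- by move=> s t u; rewrite addrA.
- by move=> s t; rewrite addrC.
- by move=> s; rewrite add0r.
- by move=> s; rewrite addNr.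
- by move=> a b s; rewrite scalerA.
- by move=> s; rewrite scale1r.
- by move=> a s t; rewrite scalerDr.
- by move=> a b s; rewrite scalerDl.
Qed.

Lemma plift_cls s : plift_fun (pcls s) = mod_eval s.
Proof. exact/mod_eval_cong/prep_cls. Qed.

Lemma plift_linear : linear plift_fun.
Proof.
move=> a; elim/pcls_ind=> s; elim/pcls_ind=> t.
by case: pclsE => _ _ eD eZ; rewrite -eZ -eD !plift_cls.
Qed.

Lemma plift_gen x : plift_fun (pgen x) = f x.
Proof. exact: plift_cls. Qed.

End Eval.

Lemma pmod_ext (M : lmodType k) (f g : {linear pmod -> M}) :
  (forall x, f (pgen x) = g (pgen x)) -> f = g.
Proof.
move=> fg; apply: lin_ext; elim/pcls_ind=> s.
case: pclsE => e0 eN eD eZ.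
elim: s => [x||s IHs|s IHs t IHt|a s IHs].
- exact: fg.
- by rewrite e0 !linear0.
- by rewrite eN !linearN IHs.
- by rewrite eD !linearD IHs IHt.
- by rewrite eZ !linearZ IHs.
Qed.

End PresentedModule.

(** * Tensor product of two modules *)

Section Tensor.
Variables (k : comPzRingType) (U W : lmodType k).

Inductive tens_rel :
  mod_expr k (U * W) -> mod_expr k (U * W) -> Prop :=
| TensRelL a u u' w : tens_rel (MGen k (a *: u + u', w))
    (MAdd (MScale a (MGen k (u, w))) (MGen k (u', w)))
| TensRelR a u w w' : tens_rel (MGen k (u, a *: w + w'))
    (MAdd (MScale a (MGen k (u, w))) (MGen k (u, w'))).

Definition tens : lmodType k := pmod tens_rel.

Definition tpure (u : U) (w : W) : tens := pgen tens_rel (u, w).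

Lemma tpure_linl w : linear (tpure^~ w).
Proof.
move=> a u u'; case: (pclsE tens_rel) => _ _ eD eZ.
by rewrite -eZ -eD; apply/pclsP/mc_rel; left.
Qed.

Lemma tpure_linr u : linear (tpure u).
Proof.
move=> a w w'; case: (pclsE tens_rel) => _ _ eD eZ.
by rewrite -eZ -eD; apply/pclsP/mc_rel; right.
Qed.

Lemma tpureZl a u w : tpure (a *: u) w = a *: tpure u w.
Proof. exact: (linearZ_LR (mklin (tpure_linl w))). Qed.

Lemma tpureZr a u w : tpure u (a *: w) = a *: tpure u w.
Proof. exact: (linearZ_LR (mklin (tpure_linr u))). Qed.

Section Lift.
Variables (M : lmodType k) (f : U -> W -> M).
Hypothesis fl : forall w, linear (f^~ w).
Hypothesis fr : forall u, linear (f u).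

Fact tens_lift_subproof :
  linear (plift_fun (E := tens_rel) (fun p => f p.1 p.2)).
Proof. by apply: plift_linear => s t [a u u' w|a u w w'] /=; rewrite ?fl ?fr. Qed.
Definition tens_lift : {linear tens -> M} := mklin tens_lift_subproof.

Lemma tens_lift_pure u w : tens_lift (tpure u w) = f u w.
Proof.
by apply: (plift_gen (f := fun p => f p.1 p.2)) => s t [a v v' z|a v z z'] /=;
   rewrite ?fl ?fr.
Qed.
End Lift.

Lemma tens_ext (M : lmodType k) (f g : {linear tens -> M}) :
  (forall u w, f (tpure u w) = g (tpure u w)) -> f = g.
Proof. by move=> fg; apply: pmod_ext => -[u w]; apply: fg. Qed.

End Tensor.

(** * Tensor powers *)

Section TensorPower.
Variables (k : comPzRingType) (V : lmodType k).

Definition upd n (v : 'I_n -> V) (i : 'I_n) (x : V) : 'I_n -> V :=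
  fun j => if j == i then x else v j.

Definition multilinear n (M : lmodType k) (f : ('I_n -> V) -> M) :=
  forall i v a x y,
    f (upd v i (a *: x + y)) = a *: f (upd v i x) + f (upd v i y).

Inductive tpow_rel n :
  mod_expr k ('I_n -> V) -> mod_expr k ('I_n -> V) -> Prop :=
| TpowRel i v a x y : tpow_rel (MGen k (upd v i (a *: x + y)))
    (MAdd (MScale a (MGen k (upd v i x))) (MGen k (upd v i y))).

(* V^{\otimes n}, generated by the n-tuples subject to multilinearity; the
   first tensor power is V itself.  Taking tensor powers as n-fold products
   makes (V^{\otimes a}) \otimes (V^{\otimes b}) = V^{\otimes (a+b)} strict. *)
Definition tpow n : lmodType k :=
  match n with
  | 1 => V
  | _ => pmod (@tpow_rel n)
  end.

Definition tprod n : ('I_n -> V) -> tpow n :=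
  match n return ('I_n -> V) -> tpow n with
  | 0 => pgen (@tpow_rel 0)
  | 1 => fun v => v ord0
  | m.+2 => pgen (@tpow_rel m.+2)
  end.

Lemma upd_ord1 (v : 'I_1 -> V) i x : upd v i x = fun=> x.
Proof. by apply/funext => j; rewrite /upd [j]ord1 [i]ord1 eqxx. Qed.

Lemma tprod_multilinear n : multilinear (@tprod n).
Proof.
case: n => [|[|n]]; first by case.
  by move=> i v a x y; rewrite !upd_ord1.
move=> i v a x y; case: (pclsE (@tpow_rel n.+2)) => _ _ eD eZ.
by rewrite -eZ -eD; apply/pclsP/mc_rel.
Qed.

Section Lift.
Variables (M : lmodType k) (n : nat) (f : ('I_n -> V) -> M).
Hypothesis fP : multilinear f.

Definition tpow_lift_fun : tpow n -> M :=
  match n return (('I_n -> V) -> M) -> tpow n -> M with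
  | 0 => fun g => plift_fun g
  | 1 => fun g x => g (fun=> x)
  | m.+2 => fun g => plift_fun g
  end f.

Fact tpow_lift_subproof : linear tpow_lift_fun.
Proof.
rewrite /tpow_lift_fun; case: n f fP => [|[|m]] g gP.
- by apply: plift_linear => s t [] [].
- move=> a x y; have := gP ord0 (fun=> 0) a x y.
  by rewrite !upd_ord1.
- by apply: plift_linear => s t [i v a x y] /=; apply: gP.
Qed.
Definition tpow_lift : {linear tpow n -> M} := mklin tpow_lift_subproof.

Lemma tpow_lift_prod v : tpow_lift (tprod v) = f v.
Proof.
rewrite /= /tpow_lift_fun /tprod; case: n f fP v => [|[|m]] g gP v.
- by apply: plift_gen => s t [] [].
- by congr g; apply/funext => j; rewrite [j]ord1.
- by apply: plift_gen => s t [i w a x y] /=; apply: gP.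
Qed.
End Lift.

Lemma tpow_ext n (M : lmodType k) (f g : {linear tpow n -> M}) :
  (forall v, f (tprod v) = g (tprod v)) -> f = g.
Proof.
case: n f g => [|[|n]] f g fg; try exact: pmod_ext.
by apply: lin_ext => x; apply: (fg (fun=> x)).
Qed.

Definition vcat a b (u : 'I_a -> V) (w : 'I_b -> V) : 'I_(a + b) -> V :=
  fun i => match split i with inl j => u j | inr j => w j end.

Lemma vcat_updl a b (u : 'I_a -> V) (w : 'I_b -> V) i x :
  vcat (upd u i x) w = upd (vcat u w) (lshift b i) x.
Proof.
apply/funext => j; rewrite /vcat /upd; case: split_ordP => j' ->.
  by rewrite eq_lshift.
by rewrite eq_rlshift.
Qed.

Lemma vcat_updr a b (u : 'I_a -> V) (w : 'I_b -> V) i x :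
  vcat u (upd w i x) = upd (vcat u w) (rshift a i) x.
Proof.
apply/funext => j; rewrite /vcat /upd; case: split_ordP => j' ->.
  by rewrite eq_lrshift.
by rewrite eq_rshift.
Qed.

Section Concatenation.
Variables a b : nat.

Fact tcatr_subproof (u : 'I_a -> V) :
  multilinear (fun w : 'I_b -> V => tprod (vcat u w)).
Proof. by move=> i w c x y; rewrite !vcat_updr tprod_multilinear. Qed.

Fact tcat_subproof :
  multilinear (fun u : 'I_a -> V => tpow_lift (tcatr_subproof u)).
Proof.
move=> i u c x y; apply: tpow_ext => w.
rewrite lin_addE lin_scaleE !tpow_lift_prod.
by rewrite !vcat_updl tprod_multilinear.
Qed.

(* The identification V^{\otimes a} \otimes V^{\otimes b} = V^{\otimes (a+b)},
   as a bilinear map. *)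
Definition tcat : {linear tpow a -> {linear tpow b -> tpow (a + b)}} :=
  tpow_lift tcat_subproof.

Lemma tcat_prod u w : tcat (tprod u) (tprod w) = tprod (vcat u w).
Proof. by rewrite tpow_lift_prod tpow_lift_prod. Qed.
End Concatenation.

Section TensorOfMaps.
Variables a b c d : nat.
Variables (f : {linear tpow a -> tpow c}) (g : {linear tpow b -> tpow d}).

Definition tmap_prod (v : 'I_(a + b) -> V) : tpow (c + d) :=
  tcat c d (f (tprod (fun i => v (lshift b i))))
           (g (tprod (fun j => v (rshift a j)))).

Fact tmap_subproof : multilinear tmap_prod.
Proof.
have updl (v : 'I_(a + b) -> V) i x :
    (fun j => upd v (lshift b i) x (lshift b j))
      = upd (fun j => v (lshift b j)) i x.
  by apply/funext => j; rewrite /upd eq_lshift.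
have updlr (v : 'I_(a + b) -> V) i x :
    (fun j => upd v (lshift b i) x (rshift a j)) = (fun j => v (rshift a j)).
  by apply/funext => j; rewrite /upd eq_rlshift.
have updr (v : 'I_(a + b) -> V) i x :
    (fun j => upd v (rshift a i) x (rshift a j))
      = upd (fun j => v (rshift a j)) i x.
  by apply/funext => j; rewrite /upd eq_rshift.
have updrl (v : 'I_(a + b) -> V) i x :
    (fun j => upd v (rshift a i) x (lshift b j)) = (fun j => v (lshift b j)).
  by apply/funext => j; rewrite /upd eq_lrshift.
move=> i v r x y; rewrite /tmap_prod.
case: (split_ordP i) => j ->; rewrite !(updl, updlr, updr, updrl).
  by rewrite tprod_multilinear !linearP lin_addE lin_scaleE.
by rewrite tprod_multilinear !linearP.
Qed.
(* The tensor product f \otimes g of two linear maps. *)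
Definition tmap : {linear tpow (a + b) -> tpow (c + d)} :=
  tpow_lift tmap_subproof.

Lemma tmap_cat x y : tmap (tcat a b x y) = tcat c d (f x) (g y).
Proof.
pose h1 (z : tpow a) := lin_comp tmap (tcat a b z).
pose h2 (z : tpow a) := lin_comp (tcat c d (f z)) g.
have h1P : linear h1.
  move=> r z z'; apply: lin_ext => w.
  have h1E t : h1 t w = tmap (tcat a b t w) by [].
  by rewrite lin_addE lin_scaleE !h1E linearP lin_addE lin_scaleE linearP.
have h2P : linear h2.
  move=> r z z'; apply: lin_ext => w.
  have h2E t : h2 t w = tcat c d (f t) (g w) by [].
  by rewrite lin_addE lin_scaleE !h2E !linearP lin_addE lin_scaleE.
suff h12 : mklin h1P = mklin h2P.
  have : mklin h1P x y = mklin h2P x y by rewrite h12.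
  by [].
apply: tpow_ext => u; apply: tpow_ext => w.
have -> : mklin h1P (tprod u) (tprod w) = tmap (tcat a b (tprod u) (tprod w)).
  by [].
rewrite tcat_prod tpow_lift_prod /tmap_prod.
congr (tcat c d (f (tprod _)) (g (tprod _))); apply/funext => i; rewrite /vcat.
  by case: split_ordP => j /eqP; rewrite ?eq_lshift ?eq_lrshift // => /eqP ->.
by case: split_ordP => j /eqP; rewrite ?eq_rlshift ?eq_rshift // => /eqP ->.
Qed.
End TensorOfMaps.

End TensorPower.

Arguments tcat {k V} a b.
Arguments tmap {k V a b c d} f g.

Notation "f ∘ g" := (lin_comp f g) (at level 40, left associativity).
Notation "f ⊗ g" := (tmap f g) (at level 38, left associativity).

(* Hom(V^{\otimes n}, V^{\otimes m}). *)
Notation THom V n m := {linear tpow V n -> tpow V m}.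

Definition tid (k : comPzRingType) (V : lmodType k) (n : nat) : THom V n n :=
  lin_id (tpow V n).
Arguments tid {k V} n.

(** * Braided algebras *)

Section BraidedAlgebra.
Variables (k : comPzRingType) (V : lmodType k).
Let I1 : THom V 1 1 := tid 1.
Let I2 : THom V 2 2 := tid 2.

Definition yang_baxter_operator (R : THom V 2 2) : Prop :=
  bijective R /\
  (R ⊗ I1) ∘ (I1 ⊗ R) ∘ (R ⊗ I1) = (I1 ⊗ R) ∘ (R ⊗ I1) ∘ (I1 ⊗ R).

Definition associative_mul (mu : THom V 2 1) : Prop :=
  mu ∘ (mu ⊗ I1) = mu ∘ (I1 ⊗ mu).

Definition braided_algebra (mu : THom V 2 1) (R : THom V 2 2) : Prop :=
  [/\ associative_mul mu,
      yang_baxter_operator R,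
      (I1 ⊗ mu) ∘ (R ⊗ I1) ∘ (I1 ⊗ R) = R ∘ (mu ⊗ I1)
    & (mu ⊗ I1) ∘ (I1 ⊗ R) ∘ (R ⊗ I1) = R ∘ (I1 ⊗ mu)].

(** * Yang-Baxter Hochschild cohomology *)

Definition C2_YBH : lmodType k := (THom V 2 2 * THom V 2 1)%type.

Definition C3_YBH : lmodType k :=
  (THom V 3 3 * THom V 3 2 * THom V 3 2 * THom V 3 1)%type.

Definition C4_YBH : lmodType k :=
  (THom V 4 4 * (THom V 4 3 * THom V 4 3)
   * (THom V 4 2 * THom V 4 2 * THom V 4 2) * THom V 4 1)%type.

Variables (mu : THom V 2 1) (R : THom V 2 2).

Definition delta2_YB (phi : THom V 2 2) : THom V 3 3 :=
  (R ⊗ I1) ∘ (I1 ⊗ R) ∘ (phi ⊗ I1)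
  + (R ⊗ I1) ∘ (I1 ⊗ phi) ∘ (R ⊗ I1)
  + (phi ⊗ I1) ∘ (I1 ⊗ R) ∘ (R ⊗ I1)
  - (I1 ⊗ R) ∘ (R ⊗ I1) ∘ (I1 ⊗ phi)
  - (I1 ⊗ R) ∘ (phi ⊗ I1) ∘ (I1 ⊗ R)
  - (I1 ⊗ phi) ∘ (R ⊗ I1) ∘ (I1 ⊗ R).

Definition delta2_H (psi : THom V 2 1) : THom V 3 1 :=
  mu ∘ (psi ⊗ I1) + psi ∘ (mu ⊗ I1)
  - mu ∘ (I1 ⊗ psi) - psi ∘ (I1 ⊗ mu).

Definition delta2_YI (phi : THom V 2 2) (psi : THom V 2 1) : THom V 3 2 :=
  (I1 ⊗ psi) ∘ (R ⊗ I1) ∘ (I1 ⊗ R)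
  + (I1 ⊗ mu) ∘ (phi ⊗ I1) ∘ (I1 ⊗ R)
  + (I1 ⊗ mu) ∘ (R ⊗ I1) ∘ (I1 ⊗ phi)
  - R ∘ (psi ⊗ I1) - phi ∘ (mu ⊗ I1).

Definition delta2_IY (phi : THom V 2 2) (psi : THom V 2 1) : THom V 3 2 :=
  (psi ⊗ I1) ∘ (I1 ⊗ R) ∘ (R ⊗ I1)
  + (mu ⊗ I1) ∘ (I1 ⊗ phi) ∘ (R ⊗ I1)
  + (mu ⊗ I1) ∘ (I1 ⊗ R) ∘ (phi ⊗ I1)
  - R ∘ (I1 ⊗ psi) - phi ∘ (I1 ⊗ mu).

Definition delta2_YBH (c : C2_YBH) : C3_YBH :=
  let: (phi, psi) := c in
  (delta2_YB phi, delta2_YI phi psi, delta2_IY phi psi, delta2_H psi).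

Let R1 : THom V 4 4 := R ⊗ I2.
Let R2 : THom V 4 4 := I1 ⊗ R ⊗ I1.
Let R3 : THom V 4 4 := I2 ⊗ R.

Definition delta3_YB (beta : THom V 3 3) : THom V 4 4 :=
  let b1 : THom V 4 4 := beta ⊗ I1 in
  let b2 : THom V 4 4 := I1 ⊗ beta in
  b1 ∘ R3 ∘ R2 ∘ R1 + R2 ∘ R1 ∘ b2 ∘ R1
  + R2 ∘ R3 ∘ b1 ∘ R3 + b2 ∘ R1 ∘ R2 ∘ R3
  - R1 ∘ R2 ∘ R3 ∘ b1 - R1 ∘ b2 ∘ R1 ∘ R2
  - R3 ∘ b1 ∘ R3 ∘ R2 - R3 ∘ R2 ∘ R1 ∘ b2.

Definition delta31_YI (beta : THom V 3 3) (alpha : THom V 3 2) : THom V 4 3 :=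
  let b1 : THom V 4 4 := beta ⊗ I1 in
  let b2 : THom V 4 4 := I1 ⊗ beta in
  (I1 ⊗ R) ∘ (alpha ⊗ I1) ∘ R3 + (I1 ⊗ alpha) ∘ R1 ∘ R2 ∘ R3
  + (I2 ⊗ mu) ∘ R2 ∘ R1 ∘ b2 + (I2 ⊗ mu) ∘ b1 ∘ R3 ∘ R2
  - beta ∘ (mu ⊗ I2) - (R ⊗ I1) ∘ (I1 ⊗ R) ∘ (alpha ⊗ I1)
  - (R ⊗ I1) ∘ (I1 ⊗ alpha) ∘ R1 ∘ R2.

Definition delta31_IY (beta : THom V 3 3) (alpha' : THom V 3 2) : THom V 4 3 :=
  let b1 : THom V 4 4 := beta ⊗ I1 in
  let b2 : THom V 4 4 := I1 ⊗ beta in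
  (R ⊗ I1) ∘ (I1 ⊗ alpha') ∘ R1 + (alpha' ⊗ I1) ∘ R3 ∘ R2 ∘ R1
  - (mu ⊗ I2) ∘ R2 ∘ R3 ∘ b1 - (mu ⊗ I2) ∘ b2 ∘ R1 ∘ R2
  + beta ∘ (I2 ⊗ mu) - (I1 ⊗ R) ∘ (R ⊗ I1) ∘ (I1 ⊗ alpha')
  - (I1 ⊗ R) ∘ (alpha' ⊗ I1) ∘ R3 ∘ R2.

Definition delta32_YI (alpha alpha' : THom V 3 2) : THom V 4 2 :=
  alpha' ∘ (mu ⊗ I2) + (mu ⊗ I1) ∘ (I1 ⊗ R) ∘ (alpha ⊗ I1)
  + (mu ⊗ I1) ∘ (I1 ⊗ alpha) ∘ R1 ∘ R2
  - alpha ∘ (I2 ⊗ mu) - (I1 ⊗ mu) ∘ (R ⊗ I1) ∘ (I1 ⊗ alpha')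
  - (I1 ⊗ mu) ∘ (alpha' ⊗ I1) ∘ R3 ∘ R2.

Definition delta33_YI (alpha : THom V 3 2) (gamma : THom V 3 1) : THom V 4 2 :=
  R ∘ (gamma ⊗ I1) + alpha ∘ (mu ⊗ I2)
  + (I1 ⊗ mu) ∘ (alpha ⊗ I1) ∘ R3
  - alpha ∘ (I1 ⊗ mu ⊗ I1) - (I1 ⊗ mu) ∘ (R ⊗ I1) ∘ (I1 ⊗ alpha)
  - (I1 ⊗ gamma) ∘ R1 ∘ R2 ∘ R3.

Definition delta33_IY (alpha' : THom V 3 2) (gamma : THom V 3 1) : THom V 4 2 :=
  - (R ∘ (I1 ⊗ gamma)) + alpha' ∘ (I2 ⊗ mu)
  + (mu ⊗ I1) ∘ (I1 ⊗ alpha') ∘ R1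
  - alpha' ∘ (I1 ⊗ mu ⊗ I1) - (mu ⊗ I1) ∘ (I1 ⊗ R) ∘ (alpha' ⊗ I1)
  + (gamma ⊗ I1) ∘ R3 ∘ R2 ∘ R1.

Definition delta3_H (gamma : THom V 3 1) : THom V 4 1 :=
  mu ∘ (gamma ⊗ I1) + mu ∘ (I1 ⊗ gamma) + gamma ∘ (I1 ⊗ mu ⊗ I1)
  - gamma ∘ (mu ⊗ I2) - gamma ∘ (I2 ⊗ mu).

Definition delta3_YBH (c : C3_YBH) : C4_YBH :=
  let: (beta, alpha, alpha', gamma) := c in
  (delta3_YB beta,
   (delta31_YI beta alpha, delta31_IY beta alpha'),
   (delta32_YI alpha alpha', delta33_YI alpha gamma, delta33_IY alpha' gamma),
   delta3_H gamma).

(* The quotient of ker delta3 by im delta2 vanishes: cocycles are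
   coboundaries. *)
Definition H3_YBH_eq0 : Prop :=
  forall c : C3_YBH, delta3_YBH c = 0 -> exists b : C2_YBH, delta2_YBH b = c.

End BraidedAlgebra.

(** * Extension of scalars along a ring morphism *)

Definition restr_scalars (k A : comPzRingType) (iota : {rmorphism k -> A})
  (M : lmodType A) : Type := M.

Section Restriction.
Variables (k A : comPzRingType) (iota : {rmorphism k -> A}) (M : lmodType A).

Local Notation restr_scalars := (restr_scalars iota M).
HB.instance Definition _ := GRing.Zmodule.on restr_scalars.

Definition restr_scale (a : k) (x : restr_scalars) : restr_scalars :=
  iota a *: (x : M).

Fact restr_scaleA a b x :
  restr_scale a (restr_scale b x) = restr_scale (a * b) x.
Proof. by rewrite /restr_scale scalerA rmorphM. Qed.
Fact restr_scale1 : left_id 1 restr_scale.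
Proof. by move=> x; rewrite /restr_scale rmorph1 scale1r. Qed.
Fact restr_scaleDr : right_distributive restr_scale +%R.
Proof. by move=> a x y; rewrite /restr_scale -scalerDr. Qed.
Fact restr_scaleDl x : {morph restr_scale^~ x : a b / a + b}.
Proof. by move=> a b; rewrite /restr_scale rmorphD scalerDl. Qed.
HB.instance Definition _ := GRing.Zmodule_isLmodule.Build k restr_scalars
  restr_scaleA restr_scale1 restr_scaleDr restr_scaleDl.

Lemma restr_scaleE (a : k) (x : restr_scalars) : a *: x = iota a *: (x : M).
Proof. by []. Qed.

End Restriction.

Definition pair2 (T : Type) (x y : T) : 'I_2 -> T :=
  fun i => if i == 0 then x else y.

Lemma upd_pair2l (k : comPzRingType) (T : lmodType k) (x y z : T) :
  upd (pair2 x y) 0 z = pair2 z y.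
Proof. by apply/funext => i; rewrite /upd /pair2; case: eqP. Qed.
Lemma upd_pair2r (k : comPzRingType) (T : lmodType k) (x y z : T) :
  upd (pair2 x y) 1 z = pair2 x z.
Proof. by apply/funext; case=> [[|[]]]. Qed.

Lemma tprod2_linl (k : comPzRingType) (T M : lmodType k)
    (f : {linear tpow T 2 -> M}) (y : T) :
  linear (fun x => f (tprod (pair2 x y))).
Proof.
move=> a x z; rewrite -(upd_pair2l 0 y (_ + _)) tprod_multilinear.
by rewrite linearP !upd_pair2l.
Qed.
Lemma tprod2_linr (k : comPzRingType) (T M : lmodType k)
    (f : {linear tpow T 2 -> M}) (x : T) :
  linear (fun y => f (tprod (pair2 x y))).
Proof.
move=> a y z; rewrite -(upd_pair2r x 0 (_ + _)) tprod_multilinear.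
by rewrite linearP !upd_pair2r.
Qed.

Lemma pair2E (T : Type) (v : 'I_2 -> T) : v = pair2 (v ord0) (v ord_max).
Proof.
apply/funext => i; rewrite /pair2; case: eqP => [->//|/eqP i0].
by congr v; apply/val_inj; case: i i0 => [[|[]]].
Qed.

Section ScalarExtension.
Variables (k A : comPzRingType) (iota : {rmorphism k -> A}) (V : lmodType k).

Local Notation restr := (restr_scalars iota).

(* V \otimes_k A, with A acting on the right-hand factor. *)
Definition scalar_ext : Type := tens V (restr A^o).
HB.instance Definition _ := GRing.Zmodule.on scalar_ext.

Definition ext_pure (x : V) (b : A) : scalar_ext := tpure x (b : restr A^o).

Fact ext_scale_subr (a : A) (x : V) :
  linear (fun b : restr A^o => tpure x (a * b : restr A^o)).
Proof.
move=> c b b'; rewrite -tpure_linr; congr tpure.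
by rewrite mulrDr; congr (_ + _); apply: mulrCA.
Qed.
Definition ext_scale (a : A) :
    {linear tens V (restr A^o) -> tens V (restr A^o)} :=
  tens_lift (fun b : restr A^o => tpure_linl (a * b : restr A^o))
            (ext_scale_subr a).

Lemma ext_scale_pure a x b : ext_scale a (ext_pure x b) = ext_pure x (a * b).
Proof. exact: tens_lift_pure. Qed.

Fact ext_scaleA a b x : ext_scale a (ext_scale b x) = ext_scale (a * b) x.
Proof.
suff <- : ext_scale a ∘ ext_scale b = ext_scale (a * b) by [].
by apply: tens_ext => u c; rewrite lin_compE !ext_scale_pure mulrA.
Qed.
Fact ext_scale1 : left_id 1 ext_scale.
Proof.
have e1 : ext_scale 1 = lin_id (tens V (restr A^o)).
  by apply: tens_ext => u c; rewrite ext_scale_pure mul1r.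
by move=> x; rewrite -[RHS]/(lin_id (tens V (restr A^o)) x) -e1.
Qed.
Fact ext_scaleDr : right_distributive ext_scale +%R.
Proof. by move=> a x y; apply: linearD. Qed.
Fact ext_scaleDl x : {morph ext_scale^~ x : a b / a + b}.
Proof.
move=> a b; rewrite -lin_addE; congr ((_ : {linear _ -> _}) x).
apply: tens_ext => u c; rewrite lin_addE !ext_scale_pure mulrDl.
by have := tpure_linr u 1 (a * c : restr A^o) (b * c); rewrite !scale1r.
Qed.
HB.instance Definition _ := GRing.Zmodule_isLmodule.Build A scalar_ext
  ext_scaleA ext_scale1 ext_scaleDr ext_scaleDl.

Lemma ext_scaleE a x b : a *: ext_pure x b = ext_pure x (a * b).
Proof. exact: ext_scale_pure. Qed.

Lemma ext_pure1_linear a x y :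
  ext_pure (a *: x + y) 1 = iota a *: ext_pure x 1 + ext_pure y 1.
Proof.
rewrite ext_scaleE mulr1 [LHS](tpure_linl (1 : restr A^o)) -tpureZr.
by congr (tpure _ _ + _); apply: mulr1.
Qed.

(* The action of k on V \otimes_k A is the restriction of that of A. *)
Lemma ext_restr_scale (a : k) (x : tens V (restr A^o)) :
  a *: x = iota a *: (x : scalar_ext).
Proof.
rewrite -[LHS]/((a *: lin_id (tens V (restr A^o))) x).
rewrite -[RHS]/(ext_scale (iota a) x); congr ((_ : {linear _ -> _}) x).
by apply: tens_ext => u c; rewrite lin_scaleE ext_scale_pure -tpureZr.
Qed.

Lemma ext_pure_scale x b : ext_pure x b = b *: ext_pure x 1.
Proof. by rewrite ext_scaleE mulr1. Qed.

(* The universal property of V \otimes_k A. *)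
Section Lift.
Variables (M : lmodType A) (h : {linear V -> restr M}).

Fact ext_lift_subl (b : restr A^o) :
  linear (fun x : V => (b : A) *: (h x : M) : restr M).
Proof.
move=> a x y; rewrite linearP [in LHS]restr_scaleE [in RHS]restr_scaleE.
by rewrite [LHS]scalerDr !scalerA mulrC.
Qed.
Fact ext_lift_subr (x : V) :
  linear (fun b : restr A^o => (b : A) *: (h x : M) : restr M).
Proof.
move=> a b b'; rewrite [in RHS]restr_scaleE scalerA.
exact: (scalerDl (h x : M) (iota a * (b : A)) (b' : A)).
Qed.
Definition ext_lift_fun : scalar_ext -> M :=
  tens_lift ext_lift_subl ext_lift_subr.

Lemma ext_lift_fun_pure x b : ext_lift_fun (ext_pure x b) = b *: (h x : M).
Proof. exact: (tens_lift_pure ext_lift_subl ext_lift_subr). Qed.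

Fact ext_lift_subproof : linear ext_lift_fun.
Proof.
move=> a x y; pose l := tens_lift ext_lift_subl ext_lift_subr.
rewrite -[LHS]/(l ((a *: x : scalar_ext) + y)) linearD; congr (_ + _).
have aP : linear (fun x : tens V (restr A^o) => a *: (l x : M) : restr M).
  move=> c z z'; rewrite linearP [in LHS]restr_scaleE [in RHS]restr_scaleE.
  by rewrite [LHS]scalerDr !scalerA mulrC.
have lE : l ∘ ext_scale a = mklin aP.
  apply: tens_ext => u c; rewrite lin_compE ext_scale_pure.
  rewrite -[RHS]/(a *: (ext_lift_fun (ext_pure u c) : M)).
  rewrite -[LHS]/(ext_lift_fun (ext_pure u (a * c))).
  by rewrite !ext_lift_fun_pure scalerA.
by rewrite -[LHS]/((l ∘ ext_scale a) x) lE.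
Qed.
Definition ext_lift : {linear scalar_ext -> M} := mklin ext_lift_subproof.

Lemma ext_lift_pure x b : ext_lift (ext_pure x b) = b *: (h x : M).
Proof. exact: ext_lift_fun_pure. Qed.
End Lift.

Lemma ext_ext (M : lmodType A) (f g : {linear scalar_ext -> M}) :
  (forall x, f (ext_pure x 1) = g (ext_pure x 1)) -> f = g.
Proof.
move=> fg.
have kP (h : {linear scalar_ext -> M}) :
    linear (h : tens V (restr A^o) -> restr M).
  by move=> a x y; rewrite ext_restr_scale [LHS]linearP.
have kfg : mklin (kP f) = mklin (kP g).
  apply: tens_ext => u c; rewrite -[LHS]/(f (ext_pure u c)).
  by rewrite -[RHS]/(g (ext_pure u c)) ext_pure_scale !linearZ fg.
by apply: lin_ext => x; rewrite -[LHS]/(mklin (kP f) x) kfg.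
Qed.

Local Notation VA := (scalar_ext : lmodType A).

Fact ext_tpow_subproof n :
  multilinear (fun v : 'I_n -> V =>
    tprod (fun i => ext_pure (v i) 1) : restr (tpow VA n)).
Proof.
move=> i v a x y.
have updE z : (fun j => ext_pure (upd v i z j) 1)
    = upd (fun j => ext_pure (v j) 1) i (ext_pure z 1).
  by apply/funext => j; rewrite /upd; case: eqP.
by rewrite !updE ext_pure1_linear tprod_multilinear.
Qed.
(* The canonical map from V^{\otimes n} to the n-th tensor power over A of
   V \otimes_k A. *)
Definition ext_tpow n : {linear tpow V n -> restr (tpow VA n)} :=
  tpow_lift (@ext_tpow_subproof n).

(* The A-linear extension of a map defined on V \otimes V is constructed by
   currying. *)
Section ExtendHom.
Variables (m : nat) (f : THom V 2 m).

Fact ext_hom_sub1 (x : V) :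
  linear (fun y => ext_tpow m (f (tprod (pair2 x y)))).
Proof. exact: (tprod2_linr (ext_tpow m ∘ f)). Qed.
Fact ext_hom_sub2 :
  linear (fun x => ext_lift (mklin (ext_hom_sub1 x))
            : restr {linear scalar_ext -> tpow VA m}).
Proof.
move=> a x y; apply: ext_ext => z.
rewrite restr_scaleE lin_addE lin_scaleE !ext_lift_pure !scale1r.
rewrite -[LHS]/(ext_tpow m (f (tprod (pair2 (a *: x + y) z)))).
exact: (tprod2_linl (ext_tpow m ∘ f) z).
Qed.
Definition ext_hom_curry :
    {linear scalar_ext -> {linear scalar_ext -> tpow VA m}} :=
  ext_lift (mklin ext_hom_sub2).

Fact ext_hom_subproof : multilinear (fun w : 'I_2 -> VA =>
  ext_hom_curry (w ord0) (w ord_max)).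
Proof.
move=> i w a x y; rewrite /upd.
have [->|->] : i = ord0 \/ i = ord_max.
  by case: i => [[|[|//]] ?]; [left|right]; apply: val_inj.
  have e : (ord_max == ord0 :> 'I_2) = false by [].
  by rewrite !eqxx !e linearP lin_addE lin_scaleE.
have e : (ord0 == ord_max :> 'I_2) = false by [].
by rewrite !eqxx !e linearP.
Qed.
Definition ext_hom : THom VA 2 m := tpow_lift ext_hom_subproof.

Lemma ext_hom_prod v :
  ext_hom (tprod (fun i => ext_pure (v i) 1)) = ext_tpow m (f (tprod v)).
Proof.
rewrite tpow_lift_prod ext_lift_pure scale1r.
rewrite -[LHS]/(ext_lift (mklin (ext_hom_sub1 (v ord0)))
  (ext_pure (v ord_max) 1)).
rewrite ext_lift_pure scale1r -[LHS]/(ext_tpow m (f (tprod (pair2 _ _)))).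
by rewrite -pair2E.
Qed.

Lemma ext_hom_unique (g : THom VA 2 m) :
  (forall v, g (tprod (fun i => ext_pure (v i) 1)) = ext_tpow m (f (tprod v))) ->
  g = ext_hom.
Proof.
move=> gE.
have gE1 x y : g (tprod (pair2 (ext_pure x 1) (ext_pure y 1)))
             = ext_hom (tprod (pair2 (ext_pure x 1) (ext_pure y 1))).
  have -> : pair2 (ext_pure x 1) (ext_pure y 1)
            = (fun i => ext_pure (pair2 x y i) 1).
    by apply/funext => i; rewrite /pair2; case: eqP.
  by rewrite gE ext_hom_prod.
have gE2 x z : g (tprod (pair2 (ext_pure x 1) z))
             = ext_hom (tprod (pair2 (ext_pure x 1) z)).
  suff e : mklin (tprod2_linr g (ext_pure x 1))
           = mklin (tprod2_linr ext_hom (ext_pure x 1)).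
    exact: (congr1 (fun l : {linear _ -> _} => l z) e).
  by apply: ext_ext => y; apply: gE1.
apply: tpow_ext => w; rewrite (pair2E w).
suff e : mklin (tprod2_linl g (w ord_max))
         = mklin (tprod2_linl ext_hom (w ord_max)).
  exact: (congr1 (fun l : {linear _ -> _} => l (w ord0)) e).
by apply: ext_ext => x; apply: gE2.
Qed.

End ExtendHom.

End ScalarExtension.

(** * Truncated power series *)

Section TruncatedSeries.
Variables (k : comPzRingType) (N : nat).

(* k[[h]]/(h^N), a class being given by its first N coefficients. *)
Definition tseries : Type := {ffun 'I_N -> k}.
HB.instance Definition _ := GRing.Zmodule.on tseries.
Implicit Types a b c : tseries.

Definition tseries_mul a b : tseries :=
  [ffun n : 'I_N => \sum_(i < N) \sum_(j < N | (i + j)%N == n) a i * b j].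

Definition tseries_const (x : k) : tseries :=
  [ffun i : 'I_N => if i == 0 :> nat then x else 0].

(* The class of h. *)
Definition hbar : tseries :=
  [ffun i : 'I_N => if i == 1 :> nat then 1 else 0].

Fact tseries_mulC : commutative tseries_mul.
Proof.
move=> a b; apply/ffunP => n; rewrite !ffunE.
rewrite (exchange_big_dep predT) //=; apply: eq_bigr => i _.
by apply: eq_big => [j|j _]; rewrite (addnC, mulrC).
Qed.

Lemma tseries_const_mulE x b (n : 'I_N) :
  tseries_mul (tseries_const x) b n = x * b n.
Proof.
rewrite ffunE; have N0 : (0 < N)%N by apply: leq_ltn_trans (ltn_ord n).
rewrite (bigD1 (Ordinal N0)) //= [X in _ + X]big1 ?addr0 => [|i i0].
  by rewrite (big_pred1 n) ?ffunE // => j; rewrite add0n.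
by rewrite big1 // => j _; rewrite ffunE -val_eqE /= in i0 *;
   rewrite (negbTE i0) mul0r.
Qed.

Fact tseries_mul1 : left_id (tseries_const 1) tseries_mul.
Proof. by move=> a; apply/ffunP => n; rewrite tseries_const_mulE mul1r. Qed.

Fact tseries_mulDl : left_distributive tseries_mul +%R.
Proof.
move=> a b c; apply/ffunP => n; rewrite !ffunE -big_split /=.
apply: eq_bigr => i _; rewrite -big_split; apply: eq_bigr => j _.
by rewrite ffunE mulrDl.
Qed.

Lemma tseries_mul3 a b c (n : 'I_N) :
  tseries_mul a (tseries_mul b c) n =
  \sum_(i < N) \sum_(j < N) \sum_(l < N | (i + j + l)%N == n)
    a i * (b j * c l).
Proof.
rewrite ffunE; apply: eq_bigr => i _.
under eq_bigr => m _ do rewrite ffunE mulr_sumr.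
rewrite exchange_big /=; apply: eq_bigr => j _.
under eq_bigr => m _ do rewrite mulr_sumr.
rewrite (exchange_big_dep (fun l : 'I_N => (i + j + l)%N == n)) /=; last first.
  by move=> m l /eqP <- /eqP <-; rewrite addnA.
apply: eq_bigr => l /eqP ijl.
have jlN : (j + l < N)%N.
  by rewrite (leq_ltn_trans _ (ltn_ord n)) // -ijl -addnA leq_addl.
rewrite (big_pred1 (Ordinal jlN)) // => m /=; rewrite -val_eqE /= -ijl.
rewrite -addnA [(j + l)%N == m]eq_sym.
by case: (nat_of_ord m =P (j + l)%N) => [->|_]; rewrite ?eqxx ?andbF.
Qed.

Fact tseries_mulA : associative tseries_mul.
Proof.
move=> a b c; apply/ffunP => n; rewrite [in RHS]tseries_mulC !tseries_mul3.
rewrite [RHS]exchange_big; apply: eq_bigr => i _.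
rewrite (exchange_big_dep predT) //=; apply: eq_bigr => l _.
apply: eq_big => [j|j _]; first by rewrite addnAC [(l + i)%N]addnC.
by rewrite mulrA mulrC.
Qed.

HB.instance Definition _ := GRing.Zmodule_isComPzRing.Build tseries
  tseries_mulA tseries_mulC tseries_mul1 tseries_mulDl.

Fact tseries_const_add : zmod_morphism tseries_const.
Proof.
by move=> x y; apply/ffunP => i; rewrite !ffunE; case: eqP; rewrite ?subr0.
Qed.
Fact tseries_const_mul : monoid_morphism tseries_const.
Proof.
split=> // x y; apply/ffunP => n; rewrite tseries_const_mulE !ffunE.
by case: eqP; rewrite ?mulr0.
Qed.
HB.instance Definition _ :=
  GRing.isZmodMorphism.Build k tseries tseries_const tseries_const_add.
HB.instance Definition _ :=
  GRing.isMonoidMorphism.Build k tseries tseries_const tseries_const_mul.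

End TruncatedSeries.

(** * Deformations *)

Section Deformation.
Variables (k : comPzRingType) (V : lmodType k).

(* V \otimes k[[h]]/(h^N) *)
Definition series_module (N : nat) : lmodType (tseries k N) :=
  scalar_ext (tseries_const N : {rmorphism k -> tseries k N}) V.

(* The k[[h]]/(h^N)-linear extension of f. *)
Definition series_hom (N m : nat) (f : THom V 2 m) :
    THom (series_module N) 2 m :=
  ext_hom (tseries_const N : {rmorphism k -> tseries k N}) f.

Variables (mu : THom V 2 1) (R : THom V 2 2).

Definition infinitesimal_deformation
    (psi1 : THom V 2 1) (phi1 : THom V 2 2) : Prop :=
  let h := hbar k 2 in
  let ext m (f : THom V 2 m) := series_hom 2 f in
  braided_algebra (ext 1 mu + h *: ext 1 psi1)
                  (ext 2 R + h *: ext 2 phi1).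

Definition quadratic_deformation (psi1 : THom V 2 1) (phi1 : THom V 2 2)
    (psi2 : THom V 2 1) (phi2 : THom V 2 2) : Prop :=
  let h := hbar k 3 in
  let ext m (f : THom V 2 m) := series_hom 3 f in
  braided_algebra (ext 1 mu + h *: ext 1 psi1 + h ^+ 2 *: ext 1 psi2)
                  (ext 2 R + h *: ext 2 phi1 + h ^+ 2 *: ext 2 phi2).

End Deformation.

(* Main.v *)
Require Import Defs.
From mathcomp Require Import all_boot all_algebra.
From mathcomp Require Import boolp.

Set Implicit Arguments.
Unset Strict Implicit.
Unset Printing Implicit Defensive.

Import GRing.Theory.

Local Open Scope ring_scope.

(** Write each axiom of a braided algebra as a defect, left-hand side minus
    right-hand side: [defect_YB], [defect_YI], [defect_IY] and [defect_H].
    Evaluate the defects at mu + h psi1 + h^2 psi2 and R + h phi1 + h^2 phi2.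
    The coefficient of h^0 is the defect of (mu, R), that of h is
    delta2 (phi1, psi1), and that of h^2 is delta2 (phi2, psi2) plus a cochain
    [obstruction] that is quadratic in (phi1, psi1) ([defect_YB_expands] and
    its companions).  Hence the infinitesimal deformation extends as soon as
    the obstruction is a coboundary delta2 b, the extension being given by - b;
    as H^3 = 0, it is enough that the obstruction is a cocycle.

    That rests on [delta3_defect]: for every mu and R whatsoever, delta3 of the
    tuple of defects of (mu, R), with delta3 formed from the same mu and R,
    vanishes.  This is a formal identity, in which only the interchange law
    between maps acting on disjoint tensor factors is used.  Apply it over
    k[[h]]/(h^3) to the deformed structure with psi2 = phi2 = 0.  The defects
    there are h^2 times the obstruction, and since h^3 = 0 only the constant
    terms mu and R of the deformed structure matter in delta3: the identity
    becomes h^2 delta3 (obstruction) = 0 ([delta3_leading]).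

    The passage between k and k[[h]]/(h^N) uses two facts about the tensor
    powers of V_h = V (x) k[[h]]/(h^N).  A map out of V_h^n is determined by its
    restriction to V^n ([tpow_ext_unit]), so equalities of maps may be checked
    on coefficients; and the coefficients of an element y0 + h y1 + h^2 y2 of
    V_h^n, with y_i in V^n, are well determined ([hsum_inj]). *)

(** * Linear maps *)

Section LinearMapLemmas.
Variables (k : comPzRingType) (U V W : lmodType k).

Lemma lin_zeroE (x : U) : (0 : {linear U -> V}) x = 0. Proof. by []. Qed.

Lemma lin_oppE (f : {linear U -> V}) x : (- f) x = - f x. Proof. by []. Qed.

Lemma lin_mapD (f : {linear U -> V}) x y : f (x + y) = f x + f y.
Proof. exact: linearD. Qed.

Lemma lin_mapN (f : {linear U -> V}) x : f (- x) = - f x.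
Proof. exact: linearN. Qed.

Lemma lin_congr (f g : {linear U -> V}) : f = g -> f =1 g.
Proof. by move=> ->. Qed.

Lemma lin_comp0l (f : {linear U -> V}) : (0 : {linear V -> W}) ∘ f = 0.
Proof. exact: lin_ext. Qed.

Lemma lin_comp0r (g : {linear V -> W}) : g ∘ (0 : {linear U -> V}) = 0.
Proof. by apply: lin_ext => x; apply: linear0. Qed.

Lemma lin_compNl (g : {linear V -> W}) (f : {linear U -> V}) :
  (- g) ∘ f = - (g ∘ f).
Proof. exact: lin_ext. Qed.

Lemma lin_compNr (g : {linear V -> W}) (f : {linear U -> V}) :
  g ∘ (- f) = - (g ∘ f).
Proof. by apply: lin_ext => x; apply: linearN. Qed.

End LinearMapLemmas.

(** Closes an identity s = 0 in which every element occurring in the sum s occurs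
    once with each sign: the opposite of the last term is moved next to it and
    both are removed, until nothing is left.  The zero put in front lets the
    first term be moved like the others. *)
Ltac zmod_cancel :=
  rewrite ?(opprD, opprK, addrA) -[LHS]add0r ?addrA;
  repeat match goal with
  | |- ?s + - ?u = 0 => repeat rewrite (addrAC _ u); rewrite subrK
  | |- ?s + ?u = 0 => repeat rewrite (addrAC _ (- u)); rewrite addrK
  end; try reflexivity.

(** * Tensor products of linear maps *)

Section TensorCalculus.
Variables (k : comPzRingType) (V : lmodType k).

Lemma tpow_linear_ext n (M : lmodType k) (f g : tpow V n -> M) :
  linear f -> linear g -> (forall v, f (tprod v) = g (tprod v)) -> f =1 g.
Proof.
move=> lf lg fg x; suff e : mklin lf = mklin lg by exact: (lin_congr e x).
exact: tpow_ext.
Qed.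

Lemma tprod_split a b (v : 'I_(a + b) -> V) :
  tprod v = tcat a b (tprod (fun i => v (lshift b i)))
                     (tprod (fun j => v (rshift a j))).
Proof.
rewrite tcat_prod; congr tprod; apply/funext => i; rewrite /vcat.
by case: split_ordP => j ->.
Qed.

Lemma tcat_ext a b n (f g : THom V (a + b) n) :
  (forall x y, f (tcat a b x y) = g (tcat a b x y)) -> f = g.
Proof. by move=> fg; apply: tpow_ext => v; rewrite tprod_split. Qed.

Lemma tmap_comp a b c a' b' c' (g : THom V b c) (f : THom V a b)
    (g' : THom V b' c') (f' : THom V a' b') :
  (g ∘ f) ⊗ (g' ∘ f') = (g ⊗ g') ∘ (f ⊗ f').
Proof. by apply: tcat_ext => x y; rewrite lin_compE !tmap_cat. Qed.

Lemma tmap_id a b : (tid a : THom V a a) ⊗ tid b = tid (a + b).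
Proof. by apply: tcat_ext => x y; rewrite tmap_cat. Qed.

Section Linearity.
Variables a b c d : nat.
Implicit Types (f : THom V a c) (g : THom V b d).

Lemma tmapDl f f' g : (f + f') ⊗ g = f ⊗ g + f' ⊗ g.
Proof.
by apply: tcat_ext => x y; rewrite lin_addE !tmap_cat lin_addE linearD lin_addE.
Qed.

Lemma tmapDr f g g' : f ⊗ (g + g') = f ⊗ g + f ⊗ g'.
Proof.
by apply: tcat_ext => x y; rewrite lin_addE !tmap_cat lin_addE linearD.
Qed.

Lemma tmapNl f g : (- f) ⊗ g = - (f ⊗ g).
Proof.
apply: tcat_ext => x y; rewrite [RHS]lin_oppE !tmap_cat.
by rewrite [(- f) x]lin_oppE linearN.
Qed.

Lemma tmapNr f g : f ⊗ (- g) = - (f ⊗ g).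
Proof.
apply: tcat_ext => x y; rewrite [RHS]lin_oppE !tmap_cat.
by rewrite [(- g) y]lin_oppE linearN.
Qed.

Lemma tmap0l g : (0 : THom V a c) ⊗ g = 0.
Proof.
by apply: tcat_ext => x y; rewrite tmap_cat !lin_zeroE linear0 lin_zeroE.
Qed.

Lemma tmap0r f : f ⊗ (0 : THom V b d) = 0.
Proof. by apply: tcat_ext => x y; rewrite tmap_cat !lin_zeroE linear0. Qed.

End Linearity.

Lemma tmap_compl n a b c (g : THom V b c) (f : THom V a b) :
  (g ∘ f) ⊗ (tid n : THom V n n) = (g ⊗ tid n) ∘ (f ⊗ tid n).
Proof. by rewrite -tmap_comp; congr tmap; apply: lin_ext. Qed.

Lemma tmap_compr n a b c (g : THom V b c) (f : THom V a b) :
  (tid n : THom V n n) ⊗ (g ∘ f) = (tid n ⊗ g) ∘ (tid n ⊗ f).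
Proof. by rewrite -tmap_comp; congr tmap; apply: lin_ext. Qed.

Lemma tmap_interchange a b c d (f : THom V a c) (g : THom V b d) :
  (f ⊗ tid d) ∘ (tid a ⊗ g) = (tid c ⊗ g) ∘ (f ⊗ tid b).
Proof. by rewrite -!tmap_comp; congr tmap; apply: lin_ext. Qed.

(** The two ways of bracketing a triple tensor power have types that differ by
    associativity of addition, which is not a conversion for variable
    exponents.  At numerals the transport is the identity. *)
Definition tcast m n (e : m = n) : THom V m n :=
  ecast i (THom V m i) e (tid m).

Lemma tcast_prod m n (e : m = n) (v : 'I_m -> V) :
  tcast e (tprod v) = tprod (fun i => v (cast_ord (esym e) i)).
Proof. by case: _ / e; congr tprod; apply/funext => i; rewrite cast_ord_id. Qed.

Lemma tcatA a b c (e : (a + b + c)%N = (a + (b + c))%N) x y z :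
  tcast e (tcat (a + b) c (tcat a b x y) z) = tcat a (b + c) x (tcat b c y z).
Proof.
move: x; apply: tpow_linear_ext => [r x x'|r x x'|u].
- by rewrite linearP lin_addE lin_scaleE linearP lin_addE lin_scaleE linearP.
- by rewrite linearP lin_addE lin_scaleE.
move: y; apply: tpow_linear_ext => [r y y'|r y y'|v].
- by rewrite linearP [tcat _ _ (_ + _)]linearP lin_addE lin_scaleE linearP.
- by rewrite [tcat b c _]linearP lin_addE lin_scaleE linearP.
move: z; apply: tpow_linear_ext => [r z z'|r z z'|w].
- by rewrite !linearP.
- by rewrite !linearP.
rewrite !tcat_prod tcast_prod; congr tprod; apply/funext => i; rewrite /vcat.
case: (split_ordP i) => [i1|i1'] ->.
  have -> : cast_ord (esym e) (lshift (b + c) i1) = lshift c (lshift b i1).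
    exact: val_inj.
  by rewrite (unsplitK (inl _ (lshift b i1))) (unsplitK (inl _ i1)).
case: (split_ordP i1') => i2 ->.
  have -> : cast_ord (esym e) (rshift a (lshift c i2)) = lshift c (rshift a i2).
    exact: val_inj.
  by rewrite (unsplitK (inl _ (rshift a i2))) (unsplitK (inr _ i2)).
have -> : cast_ord (esym e) (rshift a (rshift b i2)) = rshift (a + b) i2.
  by apply: val_inj; rewrite /= addnA.
by rewrite (unsplitK (inr _ i2)).
Qed.

Lemma tmapA a b c a' b' c' (e : (a + b + c)%N = (a + (b + c))%N)
    (e' : (a' + b' + c')%N = (a' + (b' + c'))%N)
    (f : THom V a a') (g : THom V b b') (h : THom V c c') :
  (f ⊗ (g ⊗ h)) ∘ tcast e = tcast e' ∘ ((f ⊗ g) ⊗ h).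
Proof.
apply: tpow_ext => v; rewrite !lin_compE (@tprod_split (a + b) c v).
by rewrite (@tprod_split a b) tcatA !tmap_cat tcatA.
Qed.

Local Notation I1 := (tid 1 : THom V 1 1).
Local Notation I2 := (tid 2 : THom V 2 2).

Lemma tmap_left2 a b (f : THom V a b) : I1 ⊗ (I1 ⊗ f) = I2 ⊗ f.
Proof.
have := tmapA (erefl (1 + 1 + a)%N) (erefl (1 + 1 + b)%N) I1 I1 f.
by rewrite tmap_id => e; apply: lin_ext => x; exact: (lin_congr e x).
Qed.

Lemma tmap_both a b (f : THom V a b) : I1 ⊗ (f ⊗ I1) = I1 ⊗ f ⊗ I1.
Proof.
have e := tmapA (erefl (1 + a + 1)%N) (erefl (1 + b + 1)%N) I1 f I1.
by apply: lin_ext => x; exact: (lin_congr e x).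
Qed.

Lemma tmap_right2 a b (f : THom V a b) (e : (a + 1 + 1)%N = (a + 2)%N)
    (e' : (b + 1 + 1)%N = (b + 2)%N) :
  tcast e' ∘ ((f ⊗ I1) ⊗ I1) = (f ⊗ I2) ∘ tcast e.
Proof. by rewrite -(tmapA e e') tmap_id. Qed.

Lemma tmap_right2_22 (f : THom V 2 2) : (f ⊗ I1 ⊗ I1 : THom V 4 4) = f ⊗ I2.
Proof.
have e := @tmap_right2 2 2 f erefl erefl.
by apply: lin_ext => x; exact: (lin_congr e x).
Qed.

Lemma tmap_right2_21 (f : THom V 2 1) : (f ⊗ I1 ⊗ I1 : THom V 4 3) = f ⊗ I2.
Proof.
have e := @tmap_right2 2 1 f erefl erefl.
by apply: lin_ext => x; exact: (lin_congr e x).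
Qed.

End TensorCalculus.

(** * Syzygies between the axioms *)

Section Syzygies.
Variables (k : comPzRingType) (V : lmodType k).
Variables (mu : THom V 2 1) (R : THom V 2 2).
Local Notation I1 := (tid 1 : THom V 1 1).
Local Notation I2 := (tid 2 : THom V 2 2).

Definition defect_H : THom V 3 1 := mu ∘ (mu ⊗ I1) - mu ∘ (I1 ⊗ mu).
Definition defect_YB : THom V 3 3 :=
  (R ⊗ I1) ∘ (I1 ⊗ R) ∘ (R ⊗ I1) - (I1 ⊗ R) ∘ (R ⊗ I1) ∘ (I1 ⊗ R).
Definition defect_YI : THom V 3 2 :=
  (I1 ⊗ mu) ∘ (R ⊗ I1) ∘ (I1 ⊗ R) - R ∘ (mu ⊗ I1).
Definition defect_IY : THom V 3 2 :=
  (mu ⊗ I1) ∘ (I1 ⊗ R) ∘ (R ⊗ I1) - R ∘ (I1 ⊗ mu).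

Lemma braided_algebra_defect :
  braided_algebra mu R <->
  [/\ bijective R, defect_H = 0, defect_YB = 0, defect_YI = 0 & defect_IY = 0].
Proof.
split=> [[dH [bR dYB] dYI dIY]|[bR dH dYB dYI dIY]].
  by split=> //; apply/eqP; rewrite subr_eq0; apply/eqP.
by do !split=> //; apply/eqP; rewrite -subr_eq0; apply/eqP.
Qed.

Local Notation R1 := (R ⊗ I2 : THom V 4 4).
Local Notation R2 := (I1 ⊗ R ⊗ I1 : THom V 4 4).
Local Notation R3 := (I2 ⊗ R : THom V 4 4).
Local Notation m1 := (mu ⊗ I2 : THom V 4 3).
Local Notation m2 := (I1 ⊗ mu ⊗ I1 : THom V 4 3).
Local Notation m3 := (I2 ⊗ mu : THom V 4 3).

Let far_RR x : R1 (R3 x) = R3 (R1 x).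
Proof. exact: (lin_congr (tmap_interchange R R)). Qed.
Let far_mR x : (I1 ⊗ R : THom V 3 3) (m1 x) = m1 (R3 x).
Proof. exact: (lin_congr (esym (tmap_interchange mu R))). Qed.
Let far_Rm x : (R ⊗ I1 : THom V 3 3) (m3 x) = m3 (R1 x).
Proof. exact: (lin_congr (tmap_interchange R mu)). Qed.
Let far_mm x : (mu ⊗ I1 : THom V 3 2) (m3 x) = (I1 ⊗ mu : THom V 3 2) (m1 x).
Proof. exact: (lin_congr (tmap_interchange mu mu)). Qed.

Let YB1 : (defect_YB ⊗ I1 : THom V 4 4) = R1 ∘ R2 ∘ R1 - R2 ∘ R1 ∘ R2.
Proof. by rewrite tmapDl tmapNl !tmap_compl tmap_right2_22. Qed.
Let YB2 : (I1 ⊗ defect_YB : THom V 4 4) = R2 ∘ R3 ∘ R2 - R3 ∘ R2 ∘ R3.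
Proof.
by rewrite tmapDr tmapNr !tmap_compr (tmap_both R) (tmap_left2 R).
Qed.
Let YI1 : (defect_YI ⊗ I1 : THom V 4 3) = m2 ∘ R1 ∘ R2 - (R ⊗ I1) ∘ m1.
Proof.
by rewrite tmapDl tmapNl !tmap_compl tmap_right2_22 tmap_right2_21.
Qed.
Let YI2 : (I1 ⊗ defect_YI : THom V 4 3) = m3 ∘ R2 ∘ R3 - (I1 ⊗ R) ∘ m2.
Proof.
rewrite tmapDr tmapNr !tmap_compr (tmap_both R) (tmap_both mu).
by rewrite (tmap_left2 R) (tmap_left2 mu).
Qed.
Let IY1 : (defect_IY ⊗ I1 : THom V 4 3) = m1 ∘ R2 ∘ R1 - (R ⊗ I1) ∘ m2.
Proof.
by rewrite tmapDl tmapNl !tmap_compl tmap_right2_22 tmap_right2_21.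
Qed.
Let IY2 : (I1 ⊗ defect_IY : THom V 4 3) = m2 ∘ R3 ∘ R2 - (I1 ⊗ R) ∘ m3.
Proof.
rewrite tmapDr tmapNr !tmap_compr (tmap_both R) (tmap_both mu).
by rewrite (tmap_left2 R) (tmap_left2 mu).
Qed.
Let H1 : (defect_H ⊗ I1 : THom V 4 2) = (mu ⊗ I1) ∘ m1 - (mu ⊗ I1) ∘ m2.
Proof. by rewrite tmapDl tmapNl !tmap_compl tmap_right2_21. Qed.
Let H2 : (I1 ⊗ defect_H : THom V 4 2) = (I1 ⊗ mu) ∘ m2 - (I1 ⊗ mu) ∘ m3.
Proof. by rewrite tmapDr tmapNr !tmap_compr (tmap_both mu) (tmap_left2 mu). Qed.

(** Expands both sides at an element into signed sums of words in the elementary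
    maps, brings the words to normal form and cancels.  The four interchange
    rules, oriented as stated, have no critical pairs, so that two words that
    differ by interchanges become the same word; the elementary maps are then
    replaced by variables, which makes comparing words cheap. *)
Ltac syzygy :=
  apply: lin_ext => x;
  rewrite lin_zeroE !(lin_oppE, lin_addE) !lin_compE;
  rewrite !(lin_oppE, lin_addE) !lin_compE;
  rewrite !(opprD, opprK, lin_mapD, lin_mapN);
  rewrite ?(far_RR, far_mR, far_Rm, far_mm);
  generalize (R ⊗ I2) (I1 ⊗ R ⊗ I1) (I2 ⊗ R) (mu ⊗ I2) (I1 ⊗ mu ⊗ I1) (I2 ⊗ mu)
    (R ⊗ I1) (I1 ⊗ R) (mu ⊗ I1) (I1 ⊗ mu); intros;
  zmod_cancel.

Let delta3_YB_defect : delta3_YB R defect_YB = 0.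
Proof. by rewrite /delta3_YB YB1 YB2; syzygy. Qed.
Let delta31_YI_defect : delta31_YI mu R defect_YB defect_YI = 0.
Proof. by rewrite /delta31_YI YB1 YB2 YI1 YI2 /defect_YB; syzygy. Qed.
Let delta31_IY_defect : delta31_IY mu R defect_YB defect_IY = 0.
Proof. by rewrite /delta31_IY YB1 YB2 IY1 IY2 /defect_YB; syzygy. Qed.
Let delta32_YI_defect : delta32_YI mu R defect_YI defect_IY = 0.
Proof.
by rewrite /delta32_YI YI1 YI2 IY1 IY2 /defect_YI /defect_IY; syzygy.
Qed.
Let delta33_YI_defect : delta33_YI mu R defect_YI defect_H = 0.
Proof. by rewrite /delta33_YI YI1 YI2 H1 H2 /defect_YI; syzygy. Qed.
Let delta33_IY_defect : delta33_IY mu R defect_IY defect_H = 0.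
Proof. by rewrite /delta33_IY IY1 IY2 H1 H2 /defect_IY; syzygy. Qed.
Let delta3_H_defect : delta3_H mu defect_H = 0.
Proof. by rewrite /delta3_H H1 H2 /defect_H; syzygy. Qed.

(** The terms of each component of delta3 form a closed path: its vertices are
    composites V^4 -> V^m, taken up to interchange, each edge is one application
    of an axiom and contributes the corresponding defect, whiskered by mu and R,
    and the sum around the path telescopes.  For the last component the path is
    the pentagon of the bracketings of four factors. *)
Lemma delta3_defect :
  [/\ [/\ delta3_YB R defect_YB = 0,
          delta31_YI mu R defect_YB defect_YI = 0
        & delta31_IY mu R defect_YB defect_IY = 0],
      [/\ delta32_YI mu R defect_YI defect_IY = 0,
          delta33_YI mu R defect_YI defect_H = 0
        & delta33_IY mu R defect_IY defect_H = 0]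
    & delta3_H mu defect_H = 0].
Proof. by []. Qed.

End Syzygies.

(** * Tensor powers and extension of scalars *)

Section ScalarExtensionPowers.
Variables (k A : comPzRingType) (iota : {rmorphism k -> A}) (V : lmodType k).

Local Notation restr := (restr_scalars iota).
Local Notation ext W := (scalar_ext iota W : lmodType A).
Local Notation VA := (ext V).
Local Notation unit_at v := (fun i => ext_pure iota (v i) 1).

Fact ext_unit_subproof (W : lmodType k) :
  linear (fun x => ext_pure iota x 1 : restr (ext W)).
Proof. exact: ext_pure1_linear. Qed.
Definition ext_unit (W : lmodType k) := mklin (@ext_unit_subproof W).

Lemma ext_tpow_prod n (v : 'I_n -> V) :
  ext_tpow iota V n (tprod v) = tprod (unit_at v) :> tpow VA n.
Proof. exact: (tpow_lift_prod (@ext_tpow_subproof _ _ iota V n)). Qed.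

Section Additivity.
Variable n : nat.
Implicit Types x y : tpow V n.

(* Linearity of ext_tpow, read in the module over A rather than in its
   restriction of scalars to k. *)
Lemma ext_tpowD x y :
  ext_tpow iota V n (x + y)
    = ext_tpow iota V n x + ext_tpow iota V n y :> tpow VA n.
Proof. exact: linearD. Qed.

Lemma ext_tpowN x :
  ext_tpow iota V n (- x) = - ext_tpow iota V n x :> tpow VA n.
Proof. exact: linearN. Qed.

Lemma ext_tpow0 : ext_tpow iota V n 0 = 0 :> tpow VA n.
Proof. exact: linear0. Qed.

Lemma ext_tpowZ a x :
  ext_tpow iota V n (a *: x) = iota a *: (ext_tpow iota V n x : tpow VA n).
Proof. exact: linearZ. Qed.

End Additivity.

Lemma ext_tpow_cat a b (x : tpow V a) (y : tpow V b) :
  ext_tpow iota V (a + b) (tcat a b x y)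
    = tcat a b (ext_tpow iota V a x) (ext_tpow iota V b y) :> tpow VA (a + b).
Proof.
move: x; apply: (tpow_linear_ext
  (f := fun x => ext_tpow iota V (a + b) (tcat a b x y)
          : restr (tpow VA (a + b)))
  (g := fun x => tcat a b (ext_tpow iota V a x) (ext_tpow iota V b y)
          : restr (tpow VA (a + b)))) => [c z z'|c z z'|u].
- by rewrite linearP lin_addE lin_scaleE [LHS]linearP.
- rewrite [ext_tpow _ _ _ (_ + _)]linearP [tcat _ _ _]linearP.
  by rewrite lin_addE lin_scaleE.
move: y; apply: (tpow_linear_ext
  (f := fun y => ext_tpow iota V (a + b) (tcat a b (tprod u) y)
          : restr (tpow VA (a + b)))
  (g := fun y => tcat a b (ext_tpow iota V a (tprod u)) (ext_tpow iota V b y)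
          : restr (tpow VA (a + b)))) => [c z z'|c z z'|w].
- by rewrite linearP [LHS]linearP.
- by rewrite [ext_tpow _ _ _ (_ + _)]linearP [LHS]linearP.
have unitE : unit_at (vcat u w) = vcat (unit_at u) (unit_at w).
  by apply/funext => i; rewrite /vcat; case: split.
by rewrite tcat_prod !ext_tpow_prod tcat_prod -unitE.
Qed.

(** The image of V^n generates its scalar extension over A: the coordinates of
    a product of elements of V (x) A are replaced one after the other by
    elements of V, linearity in the coordinate treated reducing it to that
    case. *)
Lemma tpow_ext_unit n (M : lmodType A) (f g : {linear tpow VA n -> M}) :
  (forall x, f (ext_tpow iota V n x) = g (ext_tpow iota V n x)) -> f = g.
Proof.
move=> fg; apply: tpow_ext => w.
(* Coordinates below j are arbitrary, those from j on come from V. *)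
suff: forall j w,
    (forall i : 'I_n, j <= i -> exists v, w i = ext_pure iota v 1)%N ->
    f (tprod w) = g (tprod w).
  by move=> /(_ n w); apply=> i; rewrite leqNgt ltn_ord.
elim=> [|j IHj] {}w wP.
  have /choice[v vE] := fun i => wP i isT.
  have -> : w = unit_at v by apply/funext.
  by rewrite -ext_tpow_prod.
have [jn|nj] := ltnP j n; last first.
  by apply: IHj => i ji; have := ltn_ord i; rewrite ltnNge (leq_trans nj ji).
pose i0 := Ordinal jn.
have updP (h : {linear tpow VA n -> M}) :
    linear (fun x => h (tprod (upd w i0 x))).
  by move=> a x y; rewrite tprod_multilinear linearP.
have -> : w = upd w i0 (w i0).
  by apply/funext => i; rewrite /upd; case: eqP => [->|].
suff e : mklin (updP f) = mklin (updP g) by exact: (lin_congr e (w i0)).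
apply: ext_ext => x; apply: IHj => i; rewrite /upd.
case: eqP => [_ _|/eqP ii0 ji]; first by exists x.
apply: wP; rewrite ltn_neqAle ji andbT.
by apply: contraNneq ii0 => e; apply/eqP/val_inj.
Qed.

Section Bilinear.
Variables (W1 W2 W3 : lmodType k) (B : {linear W1 -> {linear W2 -> W3}}).

Fact ext_bilinear_subproof : linear (fun x => ext_lift (ext_unit W3 ∘ B x)
  : restr {linear ext W2 -> ext W3}).
Proof.
move=> a x y; apply: ext_ext => z.
rewrite restr_scaleE lin_addE lin_scaleE !ext_lift_pure !scale1r.
by rewrite !lin_compE linearP lin_addE lin_scaleE; apply: ext_pure1_linear.
Qed.
Definition ext_bilinear : {linear ext W1 -> {linear ext W2 -> ext W3}} :=
  ext_lift (mklin ext_bilinear_subproof).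

Lemma ext_bilinear_unit x y :
  ext_bilinear (ext_pure iota x 1) (ext_pure iota y 1)
    = ext_pure iota (B x y) 1.
Proof.
rewrite /ext_bilinear ext_lift_pure scale1r.
rewrite -[LHS]/(ext_lift (ext_unit W3 ∘ B x) (ext_pure iota y 1)).
by rewrite ext_lift_pure scale1r.
Qed.
End Bilinear.

(** The n-th tensor power over A of V (x) A maps to (V^n) (x) A, where
    coefficients can be read off; the map is built one factor at a time, from
    the bilinear extension of the concatenation V x V^n -> V^(n+1). *)
Lemma ext_tpow_collect n : exists t : {linear tpow VA n -> ext (tpow V n)},
  forall x, t (ext_tpow iota V n x) = ext_pure iota x 1.
Proof.
suff [t tE] : exists t : {linear tpow VA n -> ext (tpow V n)},
    forall v, t (tprod (unit_at v)) = ext_pure iota (tprod v) 1.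
  exists t; apply: (tpow_linear_ext
    (f := fun x => t (ext_tpow iota V n x) : restr (ext (tpow V n)))
    (g := fun x => ext_pure iota x 1 : restr (ext (tpow V n)))) => [a y z||v].
  - by rewrite [ext_tpow _ _ _ _]linearP [LHS]linearP.
  - exact: ext_pure1_linear.
  - by rewrite ext_tpow_prod tE.
elim: n => [|n [t tE]].
  have cP : multilinear (fun _ : 'I_0 -> VA =>
      ext_pure iota (tprod (fun=> 0 : V)) 1 : ext (tpow V 0)) by case.
  exists (tpow_lift cP) => v; rewrite tpow_lift_prod.
  by congr (ext_pure _ (tprod _) _); apply/funext; case.
pose B := ext_bilinear (tcat (V := V) 1 n).
have BP : multilinear (fun v : 'I_(1 + n) -> VA =>
    B (v (lshift n ord0)) (t (tprod (fun j => v (rshift 1 j))))).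
  move=> i v a x y; case: (split_ordP i) => j ->.
    rewrite [j]ord1 /upd !eqxx linearP lin_addE lin_scaleE.
    have e z : (fun j => if rshift 1 j == lshift n ord0 then z
                         else v (rshift 1 j)) = (fun j => v (rshift 1 j)).
      by apply/funext => l; rewrite eq_rlshift.
    by rewrite !e.
  have e z : (fun l => upd v (rshift 1 j) z (rshift 1 l))
             = upd (fun l => v (rshift 1 l)) j z.
    by apply/funext => l; rewrite /upd eq_rshift.
  have e' z : upd v (rshift 1 j) z (lshift n ord0) = v (lshift n ord0).
    by rewrite /upd eq_lrshift.
  by rewrite !e !e' tprod_multilinear !linearP.
exists (tpow_lift BP) => v; rewrite tpow_lift_prod tE ext_bilinear_unit.
by rewrite [in RHS](@tprod_split _ _ 1 n v).
Qed.

End ScalarExtensionPowers.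

(** * Expansion in powers of h *)

Lemma hbarXE (k : comPzRingType) N i (j : 'I_N) : (1 < N)%N ->
  (hbar k N ^+ i : tseries k N) j = (i == j)%:R.
Proof.
move=> N1; elim: i j => [|i IHi] j.
  by rewrite expr0 ffunE [0%N == _]eq_sym; case: eqP.
rewrite exprS ffunE (bigD1 (Ordinal N1)) //= [X in _ + X]big1 ?addr0; last first.
  move=> a a1; apply: big1 => b _; rewrite ffunE.
  by move: a1; rewrite -val_eqE /= => /negbTE ->; rewrite mul0r.
have [ij|ij] := eqVneq i.+1 (j : nat).
  have iN : (i < N)%N by apply: ltn_trans (ltn_ord j); rewrite -ij.
  rewrite (big_pred1 (Ordinal iN)) => [|b].
    by rewrite ffunE IHi !eqxx mul1r.
  by rewrite /= -val_eqE -ij add1n eqSS.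
apply: big1 => b; rewrite add1n => /eqP bj; rewrite IHi.
by case: eqVneq => [ib|_]; rewrite ?mulr0 // -bj ib eqxx in ij *.
Qed.

(** The cases N = 2 and N = 3, of infinitesimal and of quadratic deformations,
    are treated together: in both h^3 = 0, and three coefficients are recorded,
    the last of which is multiplied by h^2 = 0 when N = 2. *)
Section Expansion.
Variables (k : comPzRingType) (V : lmodType k) (N : nat).
Hypotheses (N_gt1 : (1 < N)%N) (N_le3 : (N <= 3)%N).

Local Notation A := (tseries k N).
Local Notation iota := (tseries_const N : {rmorphism k -> A}).
Local Notation restr := (restr_scalars iota).
Local Notation VA := (series_module V N).
Local Notation h := (hbar k N).
Local Notation ext n := (ext_tpow iota V n).

Lemma hbar_cube : h ^+ 3 = 0 :> A.
Proof.
apply/ffunP => j; rewrite hbarXE // ffunE.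
by case: eqP (ltn_ord j) => // <-; rewrite ltnNge N_le3.
Qed.

Definition hsum n (y0 y1 y2 : tpow V n) : tpow VA n :=
  (ext n y0 : tpow VA n) + h *: (ext n y1 : tpow VA n)
  + h ^+ 2 *: (ext n y2 : tpow VA n).

Lemma hsumD n (x0 x1 x2 y0 y1 y2 : tpow V n) :
  hsum (x0 + y0) (x1 + y1) (x2 + y2) = hsum x0 x1 x2 + hsum y0 y1 y2.
Proof.
by rewrite /hsum !ext_tpowD !scalerDr [X in X + _ = _]addrACA [LHS]addrACA.
Qed.

Lemma hsumN n (x0 x1 x2 : tpow V n) :
  hsum (- x0) (- x1) (- x2) = - hsum x0 x1 x2.
Proof. by rewrite /hsum !ext_tpowN !scalerN !opprD. Qed.

Lemma hsum_const n (x : tpow V n) : hsum x 0 0 = ext n x.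
Proof. by rewrite /hsum !ext_tpow0 !scaler0 !addr0. Qed.

Lemma hsumZ n a (x0 x1 x2 : tpow V n) :
  hsum (a *: x0) (a *: x1) (a *: x2) = iota a *: hsum x0 x1 x2.
Proof.
rewrite /hsum !ext_tpowZ 2!scalerDr.
by congr (_ + _ + _); rewrite [LHS]scalerA [RHS]scalerA mulrC.
Qed.

Lemma hsum_inj n (y0 y1 y2 : tpow V n) : hsum y0 y1 y2 = 0 ->
  [/\ y0 = 0, y1 = 0 & N = 3 -> y2 = 0].
Proof.
have [t tE] := ext_tpow_collect iota V n.
have N_gt0 : (0 < N)%N by apply: ltn_trans N_gt1.
have coefPl i (a : restr A^o) : linear (fun x : tpow V n => (a : A) i *: x).
  by move=> c x y; rewrite scalerDr !scalerA mulrC.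
have coefPr i (x : tpow V n) : linear (fun a : restr A^o => (a : A) i *: x).
  move=> c a b; rewrite scalerA -scalerDl; congr (_ *: _).
  by rewrite ffunE; congr (_ + _); apply: tseries_const_mulE.
move=> e.
have coefE (j : 'I_N) :
    (0%N == j)%:R *: y0 + (1%N == j)%:R *: y1 + (2%N == j)%:R *: y2 = 0.
  pose c := tens_lift (coefPl j) (coefPr j).
  have cE i y : c (t (h ^+ i *: (ext n y : tpow VA n))) = (i == j)%:R *: y.
    rewrite linearZ_LR tE [_ *: _]ext_scaleE mulr1 -hbarXE //.
    exact: (tens_lift_pure (coefPl j) (coefPr j)).
  have e0 := cE 0%N y0; rewrite expr0 scale1r in e0.
  have e1 := cE 1%N y1; rewrite expr1 in e1.
  by rewrite -e0 -e1 -cE -!linearD -/(hsum y0 y1 y2) e !linear0.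
split.
- by have := coefE (Ordinal N_gt0); rewrite /= !scale0r scale1r !addr0.
- by have := coefE (Ordinal N_gt1); rewrite /= !scale0r scale1r addr0 add0r.
move=> N3; have N_gt2 : (2 < N)%N by rewrite N3.
by have := coefE (Ordinal N_gt2); rewrite /= !scale0r scale1r !add0r.
Qed.

(** G = f0 + h f1 + h^2 f2.  As [series_hom] extends scalars for maps out of V^2
    only, the expansion is expressed by the values of G on V^n, which determine
    G. *)
Definition expands n m (G : THom VA n m) (f0 f1 f2 : THom V n m) :=
  forall x : tpow V n, G (ext n x) = hsum (f0 x) (f1 x) (f2 x).

Lemma expands_unique n m (G G' : THom VA n m) f0 f1 f2 :
  expands G f0 f1 f2 -> expands G' f0 f1 f2 -> G = G'.
Proof. by move=> e e'; apply: tpow_ext_unit => x; rewrite e e'. Qed.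

Lemma expands_eq n m (G : THom VA n m) f0 f1 f2 f0' f1' f2' :
  expands G f0 f1 f2 -> f0 = f0' -> f1 = f1' -> f2 = f2' ->
  expands G f0' f1' f2'.
Proof. by move=> e <- <- <-. Qed.

Lemma expands_hsum n m (G : THom VA n m) f0 f1 f2 (y0 y1 y2 : tpow V n) :
  expands G f0 f1 f2 ->
  G (hsum y0 y1 y2)
    = hsum (f0 y0) (f1 y0 + f0 y1) (f2 y0 + f1 y1 + f0 y2).
Proof.
move=> e; rewrite /hsum !ext_tpowD !linearD !linearZ_LR !e /hsum.
rewrite !scalerDr !scalerA -!exprS -!exprSr -!exprD.
have h_high i : h ^+ i.+3 = 0 by rewrite -(addn3 i) exprD hbar_cube mulr0.
rewrite !h_high !scale0r !addr0 !addrA -expr2.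
by congr (_ + _ + _); apply: addrAC.
Qed.

Lemma expands_comp n m p (G : THom VA m p) (F : THom VA n m) g0 g1 g2 f0 f1 f2 :
  expands G g0 g1 g2 -> expands F f0 f1 f2 ->
  expands (G ∘ F) (g0 ∘ f0) (g1 ∘ f0 + g0 ∘ f1)
          (g2 ∘ f0 + g1 ∘ f1 + g0 ∘ f2).
Proof. by move=> eG eF x; rewrite lin_compE eF (expands_hsum _ _ _ eG). Qed.

Lemma expands_add n m (G F : THom VA n m) g0 g1 g2 f0 f1 f2 :
  expands G g0 g1 g2 -> expands F f0 f1 f2 ->
  expands (G + F) (g0 + f0) (g1 + f1) (g2 + f2).
Proof. by move=> eG eF x; rewrite lin_addE eF eG -hsumD. Qed.

Lemma expands_opp n m (G : THom VA n m) g0 g1 g2 :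
  expands G g0 g1 g2 -> expands (- G) (- g0) (- g1) (- g2).
Proof. by move=> eG x; rewrite lin_oppE eG -hsumN. Qed.

Lemma expands_id n : expands (tid n) (tid n) 0 0.
Proof. by move=> x; rewrite !lin_zeroE hsum_const. Qed.

Lemma expands_zero n m : expands (0 : THom VA n m) 0 0 0.
Proof. by move=> x; rewrite !lin_zeroE hsum_const ext_tpow0. Qed.

Lemma expands_cat a b m (G : THom VA (a + b) m) (f0 f1 f2 : THom V (a + b) m) :
  (forall x y, G (tcat a b (ext a x) (ext b y)) =
     hsum (f0 (tcat a b x y)) (f1 (tcat a b x y)) (f2 (tcat a b x y))) ->
  expands G f0 f1 f2.
Proof.
move=> Gcat; apply: (tpow_linear_ext
  (f := fun x => G (ext (a + b) x) : restr (tpow VA m))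
  (g := fun x => hsum (f0 x) (f1 x) (f2 x) : restr (tpow VA m)))
  => [c x y|c x y|v].
- by rewrite [ext_tpow _ _ _ _]linearP [LHS]linearP.
- by rewrite !linearP hsumD hsumZ.
by rewrite tprod_split ext_tpow_cat Gcat.
Qed.

Lemma tcat_hsuml a b (x0 x1 x2 : tpow V a) (y : tpow V b) :
  tcat a b (hsum x0 x1 x2) (ext b y)
    = hsum (tcat a b x0 y) (tcat a b x1 y) (tcat a b x2 y).
Proof.
by rewrite /hsum !linearD !linearZ_LR !(lin_addE, lin_scaleE) !ext_tpow_cat.
Qed.

Lemma tcat_hsumr a b (x : tpow V a) (y0 y1 y2 : tpow V b) :
  tcat a b (ext a x) (hsum y0 y1 y2)
    = hsum (tcat a b x y0) (tcat a b x y1) (tcat a b x y2).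
Proof. by rewrite /hsum !linearD !linearZ_LR !ext_tpow_cat. Qed.

Lemma expands_tmapl p n m (G : THom VA n m) f0 f1 f2 : expands G f0 f1 f2 ->
  expands (G ⊗ tid p) (f0 ⊗ tid p) (f1 ⊗ tid p) (f2 ⊗ tid p).
Proof.
by move=> eG; apply: expands_cat => x y; rewrite !tmap_cat eG tcat_hsuml.
Qed.

Lemma expands_tmapr p n m (G : THom VA n m) f0 f1 f2 : expands G f0 f1 f2 ->
  expands (tid p ⊗ G) (tid p ⊗ f0) (tid p ⊗ f1) (tid p ⊗ f2).
Proof.
by move=> eG; apply: expands_cat => x y; rewrite !tmap_cat eG tcat_hsumr.
Qed.

Lemma expands_ext m (f : THom V 2 m) : expands (series_hom N f) f 0 0.
Proof.
move=> x; rewrite !lin_zeroE hsum_const; move: x; apply: (tpow_linear_ext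
  (f := fun x => series_hom N f (ext 2 x) : restr (tpow VA m))
  (g := fun x => ext m (f x) : restr (tpow VA m))) => [c x y|c x y|v].
- by rewrite [ext_tpow _ _ _ _]linearP [LHS]linearP.
- by rewrite !linearP.
by rewrite ext_tpow_prod; apply: ext_hom_prod.
Qed.

Lemma expands_linear m (f0 f1 : THom V 2 m) :
  expands (series_hom N f0 + h *: series_hom N f1) f0 f1 0.
Proof.
move=> x; rewrite lin_addE lin_scaleE !expands_ext !lin_zeroE !hsum_const.
by rewrite /hsum ext_tpow0 scaler0 addr0.
Qed.

Lemma expands_quadratic m (f0 f1 f2 : THom V 2 m) :
  expands (series_hom N f0 + h *: series_hom N f1 + h ^+ 2 *: series_hom N f2)
          f0 f1 f2.
Proof.
move=> x; rewrite lin_addE lin_scaleE expands_linear expands_ext.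
by rewrite !lin_zeroE hsum_const /hsum ext_tpow0 scaler0 addr0.
Qed.

(** As h is nilpotent, f0 + h f1 + h^2 f2 is invertible when f0 is: the
    coefficients of the inverse are found by solving degree by degree. *)
Lemma expands_bijective (G : THom VA 2 2) (f0 f1 f2 : THom V 2 2) :
  expands G f0 f1 f2 -> bijective f0 -> bijective G.
Proof.
move=> eG [s fK sK].
have sP : linear s by apply: can2_linear fK sK.
pose S : THom V 2 2 := mklin sP.
have f0S x : f0 (S x) = x by exact: sK.
have Sf0 x : S (f0 x) = x by exact: fK.
have [s1 s1E] : exists s1 : THom V 2 2, forall x, s1 x = - S (f1 (S x)).
  by exists (- (S ∘ f1 ∘ S)).
have [s2 s2E] : exists s2 : THom V 2 2,
    forall x, s2 x = - S (f2 (S x)) - S (f1 (s1 x)).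
  by exists (- (S ∘ f2 ∘ S) - S ∘ f1 ∘ s1).
have eS := expands_quadratic S s1 s2; set H := (_ + _) in eS.
have idE := @expands_id 2.
have GH : G ∘ H = tid 2.
  apply: expands_unique (expands_comp eG eS) _.
  apply: (expands_eq idE); apply: lin_ext => x;
    rewrite ?lin_zeroE ?lin_addE !lin_compE.
  - by rewrite f0S.
  - by rewrite s1E lin_mapN f0S subrr.
  - by rewrite s2E lin_mapD !lin_mapN !f0S addrA addrAC addrK subrr.
have HG : H ∘ G = tid 2.
  apply: expands_unique (expands_comp eS eG) _.
  apply: (expands_eq idE); apply: lin_ext => x;
    rewrite ?lin_zeroE ?lin_addE !lin_compE.
  - by rewrite Sf0.
  - by rewrite s1E Sf0 addNr.
  - by rewrite s2E !s1E !lin_mapN !Sf0 opprK addrK addNr.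
by exists H => x; rewrite -lin_compE ?GH ?HG.
Qed.

(** Maps of the form h^2 c: composing one with another map only involves the
    constant term of the latter. *)
Definition leading n m (G : THom VA n m) (c : THom V n m) := expands G 0 0 c.

Lemma leading_compl n m p (G : THom VA m p) (F : THom VA n m) g0 g1 g2 c :
  expands G g0 g1 g2 -> leading F c -> leading (G ∘ F) (g0 ∘ c).
Proof.
move=> eG eF x; rewrite lin_compE eF (expands_hsum _ _ _ eG) !lin_zeroE.
by rewrite !linear0 !add0r.
Qed.

Lemma leading_compr n m p (G : THom VA m p) (F : THom VA n m) f0 f1 f2 c :
  leading G c -> expands F f0 f1 f2 -> leading (G ∘ F) (c ∘ f0).
Proof.
move=> eG eF x; rewrite lin_compE eF (expands_hsum _ _ _ eG) !lin_zeroE.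
by rewrite !addr0.
Qed.

Lemma leading_add n m (G F : THom VA n m) c c' :
  leading G c -> leading F c' -> leading (G + F) (c + c').
Proof. by move=> eG eF x; rewrite lin_addE eG eF -hsumD !lin_zeroE !addr0. Qed.

Lemma leading_opp n m (G : THom VA n m) c : leading G c -> leading (- G) (- c).
Proof. by move=> eG x; rewrite lin_oppE eG -hsumN !lin_zeroE !oppr0. Qed.

Lemma leading_tmapl p n m (G : THom VA n m) c :
  leading G c -> leading (G ⊗ tid p) (c ⊗ tid p).
Proof. by move=> eG; have := expands_tmapl (p := p) eG; rewrite !tmap0l. Qed.

Lemma leading_tmapr p n m (G : THom VA n m) c :
  leading G c -> leading (tid p ⊗ G) (tid p ⊗ c).
Proof. by move=> eG; have := expands_tmapr (p := p) eG; rewrite !tmap0r. Qed.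

Lemma leading_eq0 n m (c : THom V n m) : N = 3 -> leading 0 c -> c = 0.
Proof.
by move=> N3 e; apply: lin_ext => x; have [_ _] := hsum_inj (esym (e x)); apply.
Qed.

End Expansion.

(** Computes the expansion of a composite from those of its factors.  The
    exponents are passed explicitly because unification cannot split a numeral
    into a sum. *)
Ltac expand := repeat first
  [ eassumption
  | apply: expands_add
  | apply: expands_opp
  | apply: expands_comp
  | match goal with |- expands (@tmap _ _ ?a ?b ?c ?d ?f ?g) _ _ _ =>
      first [ apply: (@expands_tmapl _ _ _ b a c f)
            | apply: (@expands_tmapr _ _ _ a b d g) ]
    end ].

(** The same for a composite with exactly one factor of the form h^2 c. *)
Ltac lead := first
  [ eassumption
  | apply: leading_add; [lead | lead]
  | apply: leading_opp; lead
  | apply: leading_compr; [eassumption | eassumption | lead | solve [expand]]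
  | apply: leading_compl; [eassumption | eassumption | solve [expand] | lead]
  | match goal with |- leading (@tmap _ _ ?a ?b ?c ?d ?f ?g) _ =>
      first [ apply: (@leading_tmapl _ _ _ b a c f); lead
            | apply: (@leading_tmapr _ _ _ a b d g); lead ]
    end ].

(** Proves that two linear maps agree by expanding both at an element into sums
    of composites of the same maps. *)
Ltac collect :=
  apply: lin_ext => x;
  rewrite ?(lin_oppE, lin_addE, lin_compE) ?(lin_oppE, lin_addE, lin_compE)
          ?(opprD, opprK, lin_mapD, lin_mapN);
  apply/eqP; rewrite -subr_eq0; apply/eqP;
  zmod_cancel.

(** * The obstruction *)

Section Obstruction.
Variables (k : comPzRingType) (V : lmodType k).
Variables (mu : THom V 2 1) (R : THom V 2 2).
Local Notation I1 := (tid 1 : THom V 1 1).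

Section Cochain.
Variables (psi : THom V 2 1) (phi : THom V 2 2).

Definition quad_H : THom V 3 1 := psi ∘ (psi ⊗ I1) - psi ∘ (I1 ⊗ psi).
Definition quad_YB : THom V 3 3 :=
  (phi ⊗ I1) ∘ (I1 ⊗ phi) ∘ (R ⊗ I1) + (phi ⊗ I1) ∘ (I1 ⊗ R) ∘ (phi ⊗ I1)
  + (R ⊗ I1) ∘ (I1 ⊗ phi) ∘ (phi ⊗ I1)
  - (I1 ⊗ phi) ∘ (phi ⊗ I1) ∘ (I1 ⊗ R) - (I1 ⊗ phi) ∘ (R ⊗ I1) ∘ (I1 ⊗ phi)
  - (I1 ⊗ R) ∘ (phi ⊗ I1) ∘ (I1 ⊗ phi).
Definition quad_YI : THom V 3 2 :=
  (I1 ⊗ psi) ∘ (phi ⊗ I1) ∘ (I1 ⊗ R) + (I1 ⊗ psi) ∘ (R ⊗ I1) ∘ (I1 ⊗ phi)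
  + (I1 ⊗ mu) ∘ (phi ⊗ I1) ∘ (I1 ⊗ phi) - phi ∘ (psi ⊗ I1).
Definition quad_IY : THom V 3 2 :=
  (psi ⊗ I1) ∘ (I1 ⊗ phi) ∘ (R ⊗ I1) + (psi ⊗ I1) ∘ (I1 ⊗ R) ∘ (phi ⊗ I1)
  + (mu ⊗ I1) ∘ (I1 ⊗ phi) ∘ (phi ⊗ I1) - phi ∘ (I1 ⊗ psi).

Definition obstruction : C3_YBH V := (quad_YB, quad_YI, quad_IY, quad_H).

End Cochain.

Lemma delta2_zero :
  [/\ delta2_YB R 0 = 0, delta2_YI mu R 0 0 = 0, delta2_IY mu R 0 0 = 0
    & delta2_H mu 0 = 0].
Proof.
rewrite /delta2_YB /delta2_YI /delta2_IY /delta2_H.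
by split; rewrite !(tmap0l, tmap0r) !(lin_comp0l, lin_comp0r) !(oppr0, addr0).
Qed.

Lemma delta2_opp phi psi :
  [/\ delta2_YB R (- phi) = - delta2_YB R phi,
      delta2_YI mu R (- phi) (- psi) = - delta2_YI mu R phi psi,
      delta2_IY mu R (- phi) (- psi) = - delta2_IY mu R phi psi
    & delta2_H mu (- psi) = - delta2_H mu psi].
Proof.
rewrite /delta2_YB /delta2_YI /delta2_IY /delta2_H.
by split; rewrite !(tmapNl, tmapNr) !(lin_compNl, lin_compNr) !opprD.
Qed.

Section DeformedStructure.
Variable N : nat.
Hypotheses (N_gt1 : (1 < N)%N) (N_le3 : (N <= 3)%N).
Local Notation VA := (series_module V N).
Variables (muh : THom VA 2 1) (Rh : THom VA 2 2).
Variables (psi1 psi2 : THom V 2 1) (phi1 phi2 : THom V 2 2).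
Hypotheses (muhE : expands muh mu psi1 psi2) (RhE : expands Rh R phi1 phi2).

Lemma defect_H_expands :
  expands (defect_H muh) (defect_H mu) (delta2_H mu psi1)
          (delta2_H mu psi2 + quad_H psi1).
Proof.
rewrite /defect_H /delta2_H /quad_H.
by apply: expands_eq; [expand | | collect | collect].
Qed.

Lemma defect_YB_expands :
  expands (defect_YB Rh) (defect_YB R) (delta2_YB R phi1)
          (delta2_YB R phi2 + quad_YB phi1).
Proof.
rewrite /defect_YB /delta2_YB /quad_YB.
by apply: expands_eq; [expand | | collect | collect].
Qed.

Lemma defect_YI_expands :
  expands (defect_YI muh Rh) (defect_YI mu R) (delta2_YI mu R phi1 psi1)
          (delta2_YI mu R phi2 psi2 + quad_YI psi1 phi1).
Proof.
rewrite /defect_YI /delta2_YI /quad_YI.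
by apply: expands_eq; [expand | | collect | collect].
Qed.

Lemma defect_IY_expands :
  expands (defect_IY muh Rh) (defect_IY mu R) (delta2_IY mu R phi1 psi1)
          (delta2_IY mu R phi2 psi2 + quad_IY psi1 phi1).
Proof.
rewrite /defect_IY /delta2_IY /quad_IY.
by apply: expands_eq; [expand | | collect | collect].
Qed.

(** Each term of delta3 is linear in the cochain and composes it with mu and R
    only, hence on h^2 c the deformed differential is h^2 times the original
    one. *)
Lemma delta3_leading (bh : THom VA 3 3) (ah ah' : THom VA 3 2)
    (gh : THom VA 3 1) b a a' g :
  leading bh b -> leading ah a -> leading ah' a' -> leading gh g ->
  [/\ [/\ leading (delta3_YB Rh bh) (delta3_YB R b),
          leading (delta31_YI muh Rh bh ah) (delta31_YI mu R b a)
        & leading (delta31_IY muh Rh bh ah') (delta31_IY mu R b a')],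
      [/\ leading (delta32_YI muh Rh ah ah') (delta32_YI mu R a a'),
          leading (delta33_YI muh Rh ah gh) (delta33_YI mu R a g)
        & leading (delta33_IY muh Rh ah' gh) (delta33_IY mu R a' g)]
    & leading (delta3_H muh gh) (delta3_H mu g)].
Proof.
move=> bE aE a'E gE; rewrite /delta3_YB /delta31_YI /delta31_IY /delta32_YI.
by rewrite /delta33_YI /delta33_IY /delta3_H; split; try split; lead.
Qed.

Lemma leading_defect_cocycle b a a' g : N = 3 ->
  leading (defect_YB Rh) b -> leading (defect_YI muh Rh) a ->
  leading (defect_IY muh Rh) a' -> leading (defect_H muh) g ->
  delta3_YBH mu R (b, a, a', g) = 0.
Proof.
move=> N3 bE aE a'E gE; rewrite /delta3_YBH.
have [[sYB sYI1 sIY1] [s2 sYI3 sIY3] sH] := delta3_defect muh Rh.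
have [[]] := delta3_leading bE aE a'E gE.
rewrite sYB sYI1 sIY1 s2 sYI3 sIY3 sH.
move=> /(leading_eq0 N_gt1 N3) -> /(leading_eq0 N_gt1 N3) ->.
move=> /(leading_eq0 N_gt1 N3) -> [] /(leading_eq0 N_gt1 N3) ->.
move=> /(leading_eq0 N_gt1 N3) -> /(leading_eq0 N_gt1 N3) ->.
by move=> /(leading_eq0 N_gt1 N3) ->.
Qed.

End DeformedStructure.

Variables (psi1 : THom V 2 1) (phi1 : THom V 2 2).

Lemma infinitesimal_deformation_cocycle :
  infinitesimal_deformation mu R psi1 phi1 ->
  [/\ delta2_YB R phi1 = 0, delta2_YI mu R phi1 psi1 = 0,
      delta2_IY mu R phi1 psi1 = 0 & delta2_H mu psi1 = 0].
Proof.
move=> /braided_algebra_defect[_ eH eYB eYI eIY].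
have coef1 n m (f0 f1 f2 : THom V n m) :
    expands (N := 2) 0 f0 f1 f2 -> f1 = 0.
  move=> e; apply: lin_ext => x.
  by have [_ ->] := hsum_inj (N := 2) isT (esym (e x)).
have muE := expands_linear 2 mu psi1; have RE := expands_linear 2 R phi1.
have := defect_H_expands (N := 2) isT isT muE; rewrite eH => /coef1 ->.
have := defect_YB_expands (N := 2) isT isT RE; rewrite eYB => /coef1 ->.
have := defect_YI_expands (N := 2) isT isT muE RE; rewrite eYI => /coef1 ->.
by have := defect_IY_expands (N := 2) isT isT muE RE; rewrite eIY => /coef1 ->.
Qed.

Lemma obstruction_cocycle :
  braided_algebra mu R -> infinitesimal_deformation mu R psi1 phi1 ->
  delta3_YBH mu R (obstruction psi1 phi1) = 0.
Proof.
move=> /braided_algebra_defect[_ dH dYB dYI dIY].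
move=> /infinitesimal_deformation_cocycle[d1YB d1YI d1IY d1H].
have [d0YB d0YI d0IY d0H] := delta2_zero.
have muE := expands_linear 3 mu psi1; have RE := expands_linear 3 R phi1.
apply: (leading_defect_cocycle (N := 3) isT isT muE RE erefl).
- have := defect_YB_expands (N := 3) isT isT RE.
  by rewrite dYB d1YB d0YB add0r.
- have := defect_YI_expands (N := 3) isT isT muE RE.
  by rewrite dYI d1YI d0YI add0r.
- have := defect_IY_expands (N := 3) isT isT muE RE.
  by rewrite dIY d1IY d0IY add0r.
- have := defect_H_expands (N := 3) isT isT muE.
  by rewrite dH d1H d0H add0r.
Qed.

Lemma coboundary_obstruction_extends phi psi :
  braided_algebra mu R -> infinitesimal_deformation mu R psi1 phi1 ->
  delta2_YBH mu R (phi, psi) = obstruction psi1 phi1 ->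
  quadratic_deformation mu R psi1 phi1 (- psi) (- phi).
Proof.
move=> /braided_algebra_defect[bR dH dYB dYI dIY].
move=> /infinitesimal_deformation_cocycle[d1YB d1YI d1IY d1H] e.
have bYB : delta2_YB R phi = quad_YB phi1.
  exact: (congr1 (fun c : C3_YBH V => c.1.1.1) e).
have bYI : delta2_YI mu R phi psi = quad_YI psi1 phi1.
  exact: (congr1 (fun c : C3_YBH V => c.1.1.2) e).
have bIY : delta2_IY mu R phi psi = quad_IY psi1 phi1.
  exact: (congr1 (fun c : C3_YBH V => c.1.2) e).
have bH : delta2_H mu psi = quad_H psi1.
  exact: (congr1 (fun c : C3_YBH V => c.2) e).
have [NYB NYI NIY NH] := delta2_opp phi psi.
have muE := expands_quadratic 3 mu psi1 (- psi).
have RE := expands_quadratic 3 R phi1 (- phi).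
apply/braided_algebra_defect; split.
- exact: expands_bijective RE bR.
- apply: expands_unique (@expands_zero _ _ _ _ _).
  have := defect_H_expands (N := 3) isT isT muE.
  by rewrite dH d1H NH bH addNr.
- apply: expands_unique (@expands_zero _ _ _ _ _).
  have := defect_YB_expands (N := 3) isT isT RE.
  by rewrite dYB d1YB NYB bYB addNr.
- apply: expands_unique (@expands_zero _ _ _ _ _).
  have := defect_YI_expands (N := 3) isT isT muE RE.
  by rewrite dYI d1YI NYI bYI addNr.
- apply: expands_unique (@expands_zero _ _ _ _ _).
  have := defect_IY_expands (N := 3) isT isT muE RE.
  by rewrite dIY d1IY NIY bIY addNr.
Qed.

End Obstruction.

Theorem corollary6p7 (k : comPzRingType) (V : lmodType k)
    (mu : {linear tpow V 2 -> V}) (R : {linear tpow V 2 -> tpow V 2})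
    (hV : braided_algebra mu R)
    (hH3 : H3_YBH_eq0 mu R)
    (psi1 : {linear tpow V 2 -> V}) (phi1 : {linear tpow V 2 -> tpow V 2})
    (hdef : infinitesimal_deformation mu R psi1 phi1) :
  exists (psi2 : {linear tpow V 2 -> V}) (phi2 : {linear tpow V 2 -> tpow V 2}),
    quadratic_deformation mu R psi1 phi1 psi2 phi2.
Proof.
have [[phi psi] e] := hH3 _ (obstruction_cocycle hV hdef).
exists (- psi), (- phi).
exact: coboundary_obstruction_extends hV hdef e.
Qed.
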